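(* Let $X=X_\Sigma$ be a toric variety over $\mathbb{C}$ and let $\mathcal L$ be a monomial linear system on $X$. The general element of $\mathcal L$ is quasismooth if and only if for every $\sigma\in\Sigma$ such that $D_\sigma\subseteq B^*(\mathcal L)$, the collection of the non-empty polytopes among $\Delta_\sigma^\rho(\mathcal L)$, $\rho\in\sigma(1)$, is dependent.
   Context: $X=X_\Sigma$ is the normal toric variety over $\mathbb C$ of a fan $\Sigma$ in $N_{\mathbb Q}$ ($N$ a lattice), without torus factors. $\Sigma(1)$ is the set of rays of $\Sigma$, and $\sigma(1)$ the set of rays of a cone $\sigma$. The Cox ring is $R(X)=\mathbb C[x_\rho:\rho\in\Sigma(1)]$, graded by $\mathrm{Cl}(X)$ by letting $\deg x_\rho$ be the class of the torus-invariant prime divisor of $\rho$. Put $\bar X=\mathrm{Spec}\,R(X)\cong\mathbb C^{|\Sigma(1)|}$, let $J$ be the irrelevant ideal, generated by the monomials $\prod_{\rho\notin\sigma(1)}x_\rho$, $\sigma\in\Sigma$, let $\hat X=\bar X\setminus V(J)$, and let $p:\hat X\to X$ be the characteristic map, i.e. the GIT quotient by $G=\mathrm{Spec}\,\mathbb C[\mathrm{Cl}(X)]$. For a hypersurface (effective Weil divisor) $Y\subset X$, its pull-back $p^*(Y)$ is the closure in $\hat X$ of the pull-back of the Cartier divisor $Y\cap X^0$, where $X^0$ is the smooth locus of $X$; it is the divisor of a homogeneous element $f_Y\in R(X)$ restricted to $\hat X$. $Y$ is quasismooth if $p^*(Y)\subset\hat X$ is smooth, i.e. $f_Y$ and all its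 partial derivatives have no common zero in $\hat X$. A linear system $\mathcal L$ on $X$ corresponds to a (nonzero, finite-dimensional) subspace $V_{\mathcal L}\subset R(X)$ of homogeneous elements of a fixed degree via $p^*\mathcal L=\{\mathrm{div}(f):f\in V_{\mathcal L}\}$, up to scalars. It is monomial if $V_{\mathcal L}$ is generated by monomials. $B^*(\mathcal L)\subseteq\hat X$ is the base locus of $p^*\mathcal L$. ''The general element'' means every element of some non-empty Zariski open subset of $\mathcal L\cong\mathbb P(V_{\mathcal L})$. For $\sigma\in\Sigma$, $D_\sigma=\{x\in\hat X: x_\rho=0 \text{ for all }\rho\in\sigma(1)\}$. If $D_\sigma\subseteq B^*(\mathcal L)$, a general $f\in V_{\mathcal L}$ can be written $f=\sum_{\rho\in\sigma(1)}x_\rho f_\rho$, and $\Delta_\sigma^\rho(\mathcal L)\subset\mathbb R^{\Sigma(1)}$ is the Newton polytope (convex hull of the exponents of the monomials occurring) of the restriction of $f_\rho$ to $D_\sigma$ (obtained by setting $x_\tau=0$ for $\tau\in\sigma(1)$); it does not depend on the choice of the expression. Equivalently, $\Delta_\sigma^\rho(\mathcal L)+e_\rho$ is the convex hull of the exponents $m$ of monomials in $V_{\mathcal L}$ with $m_\rho=1$ and $m_\tau=0$ for $\tau\in\sigma(1)\setminus\{\rho\}$. Some of these polytopes may be empty. A collection of $\ell>0$ non-empty polytopes in $\mathbb R^n$ is degenerate if all the polytopes can be translated into one common $(\ell-1)$-dimensional linear subspace. A collection of polytopes is dependent if it contains a degenerate subcollection. By convention the empty collection is independent (not dependent). *)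

(* Defs.v *)
From HB Require Import structures.
From mathcomp Require Import all_boot all_order all_algebra.
From mathcomp Require Import classical_sets reals.
From mathcomp Require Import complex.
From mathcomp Require Import mpoly.

Set Implicit Arguments.
Unset Strict Implicit.
Unset Printing Implicit Defensive.

Import Order.TTheory GRing.Theory Num.Theory.
Local Open Scope ring_scope.

(* The lattice N is 'rV[int]_d; its dual M is identified with 'rV[int]_d by
   the standard pairing. *)
Definition pairing (K : pzRingType) (d : nat) (m v : 'rV[K]_d) : K :=
  \sum_(j < d) m 0 j * v 0 j.

Definition primitive (d : nat) (v : 'rV[int]_d) : Prop :=
  v != 0 /\ forall (k : nat) (w : 'rV[int]_d), v = k%:Z *: w -> k = 1%N.

Definition cone_of (d r : nat) (u : 'I_r -> 'rV[int]_d) (s : {set 'I_r}) :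
    set 'rV[rat]_d :=
  fun v => exists c : 'I_r -> rat, (forall i, 0 <= c i) /\
    v = \sum_(i in s) c i *: map_mx intr (u i).

Definition strongly_convex (d : nat) (C : set 'rV[rat]_d) : Prop :=
  forall v, C v -> C (- v) -> v = 0.

Definition cut_face (d : nat) (m : 'rV[rat]_d) (C : set 'rV[rat]_d) :
    set 'rV[rat]_d :=
  fun v => C v /\ pairing m v = 0.

Definition is_face (d : nat) (A C : set 'rV[rat]_d) : Prop :=
  exists m : 'rV[rat]_d,
    (forall v, C v -> 0 <= pairing m v) /\ A = cut_face m C.

(* A fan in N_Q is recorded by the primitive generators of its rays, indexed by
   'I_nrays, and the sets sigma(1) of (indices of) rays of its cones; a strongly
   convex cone is recovered from its rays as [cone_of ray sigma]. *)
Record fan (d : nat) := Fan {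
  nrays : nat;
  ray : 'I_nrays -> 'rV[int]_d;
  cones : {set {set 'I_nrays}};
  ray_primitive : forall i, primitive (ray i);
  ray_inj : injective ray;
  cones_neq0 : cones != finset.set0;
  ray_cone : forall i, finset.set1 i \in cones;
  cone_strongly_convex : forall s, s \in cones ->
    strongly_convex (cone_of ray s);
  cone_rays : forall s i, s \in cones -> i \in s ->
    is_face (cone_of ray (finset.set1 i)) (cone_of ray s);
  cone_faces : forall s A, s \in cones -> is_face A (cone_of ray s) ->
    exists2 t, t \in cones & cone_of ray t = A;
  cone_inter : forall s t, s \in cones -> t \in cones ->
    is_face (cone_of ray s `&` cone_of ray t)%classic (cone_of ray s)
}.

(* X_Sigma has no torus factors iff the rays of Sigma span N_Q. *)
Definition no_torus_factors (d : nat) (F : fan d) : Prop :=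
  row_full (\matrix_(i < nrays F) map_mx intr (ray i) : 'M[rat]_(_, d)).

Definition cox (R : realType) (d : nat) (F : fan d) :=
  {mpoly (complex R)[nrays F]}.

(* Equality of the classes of the divisors \sum_i a i D_i and \sum_i b i D_i
   in Cl(X) = Z^{Sigma(1)} / M. *)
Definition same_class (d : nat) (F : fan d) (a b : 'I_(nrays F) -> int) : Prop :=
  exists m : 'rV[int]_d, forall i, a i - b i = pairing m (ray i).

Definition homogeneous_of_class (R : realType) (d : nat) (F : fan d)
    (D : 'I_(nrays F) -> int) (f : cox R F) : Prop :=
  forall m : 'X_{1..nrays F}, m \in msupp f ->
    same_class (fun i => (m i)%:Z) D.

Definition irr_monomial (R : realType) (d : nat) (F : fan d)
    (s : {set 'I_(nrays F)}) : cox R F :=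
  \prod_(i | i \notin s) 'X_i.

(* The complement of the zero locus of the irrelevant ideal. *)
Definition hatX (R : realType) (d : nat) (F : fan d) :
    set ('I_(nrays F) -> complex R) :=
  fun x => ~ (forall s, s \in cones F -> (irr_monomial R s).@[x] = 0).

Definition quasismooth (R : realType) (d : nat) (F : fan d) (f : cox R F) : Prop :=
  ~ exists x : 'I_(nrays F) -> complex R,
      [/\ hatX x, f.@[x] = 0 & forall i, f^`M(i).@[x] = 0].

Definition Dcone (R : realType) (d : nat) (F : fan d) (s : {set 'I_(nrays F)}) :
    set ('I_(nrays F) -> complex R) :=
  fun x => hatX x /\ forall i, i \in s -> x i = 0.

(* A linear system is a nonzero finite-dimensional space V of homogeneous
   elements of a fixed degree, presented by a basis, which provides homogeneous
   coordinates on P(V). *)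
Record linear_system (R : realType) (d : nat) (F : fan d) := LinearSystem {
  ls_dim : nat;
  ls_basis : 'I_ls_dim.+1 -> cox R F;
  ls_free : forall c : 'rV[complex R]_ls_dim.+1,
    \sum_j c 0 j *: ls_basis j = 0 -> c = 0;
  ls_homog : exists D : 'I_(nrays F) -> int,
    forall j, homogeneous_of_class D (ls_basis j)
}.

Definition ls_elt (R : realType) (d : nat) (F : fan d) (L : linear_system R F)
    (c : 'rV[complex R]_(ls_dim L).+1) : cox R F :=
  \sum_j c 0 j *: ls_basis j.

Definition ls_space (R : realType) (d : nat) (F : fan d)
    (L : linear_system R F) : set (cox R F) :=
  fun f => exists c, f = ls_elt (L := L) c.

Definition monomial_system (R : realType) (d : nat) (F : fan d)
    (L : linear_system R F) : Prop :=
  exists ms : seq 'X_{1..nrays F}, forall f : cox R F,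
    ls_space L f <->
    exists a : 'X_{1..nrays F} -> complex R, f = \sum_(m <- ms) a m *: 'X_[m].

Definition base_locus (R : realType) (d : nat) (F : fan d)
    (L : linear_system R F) : set ('I_(nrays F) -> complex R) :=
  fun x => hatX x /\ forall f, ls_space L f -> f.@[x] = 0.

(* Zariski open subsets of P^k, in homogeneous coordinates: the value
   of U at 0 is irrelevant. *)
Definition zariski_open (K : fieldType) (k : nat) (U : set 'rV[K]_k.+1) : Prop :=
  exists S : set {mpoly K[k.+1]},
    (forall q, S q -> exists e : nat, q \is e.-homog) /\
    forall c, c != 0 -> (U c <-> exists2 q, S q & q.@[c 0] != 0).

Definition general (R : realType) (d : nat) (F : fan d)
    (L : linear_system R F) (P : cox R F -> Prop) : Prop :=
  exists U : set 'rV[complex R]_(ls_dim L).+1,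
    [/\ zariski_open U, (exists2 c, c != 0 & U c) &
        forall c, c != 0 -> U c -> P (ls_elt c)].

Definition newton_polytope (R : realType) (r : nat) (p : {mpoly (complex R)[r]}) :
    set 'rV[R]_r :=
  fun x => exists w : 'X_{1..r} -> R,
    [/\ forall m, 0 <= w m, \sum_(m <- msupp p) w m = 1 &
        x = \sum_(m <- msupp p) w m *: \row_i (m i)%:R].

Definition restrict_cone (R : realType) (d : nat) (F : fan d)
    (s : {set 'I_(nrays F)}) (f : cox R F) : cox R F :=
  f \mPo [tuple (if i \in s then 0 else 'X_i) | i < nrays F].

(* The polytope Delta_sigma^rho(L): the common Newton polytope of
   (f_rho restricted to D_sigma) for the general f = \sum_tau x_tau f_tau of L;
   it is meaningful when D_sigma is contained in the base locus. *)
Definition Delta (R : realType) (d : nat) (F : fan d) (L : linear_system R F)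
    (s : {set 'I_(nrays F)}) (rho : 'I_(nrays F)) : set 'rV[R]_(nrays F) :=
  fun x => general L (fun f =>
    exists2 g : 'I_(nrays F) -> cox R F,
      f = \sum_(tau in s) 'X_tau * g tau &
      newton_polytope (restrict_cone s (g rho)) x).

Definition degenerate (R : realType) (I : finType) (n : nat)
    (P : I -> set 'rV[R]_n) (T : {set I}) : Prop :=
  (0 < #|T|)%N /\
  exists W : {vspace 'rV[R]_n}, \dim W = #|T|.-1 /\
    forall i, i \in T -> exists t : 'rV[R]_n, forall x, P i x -> t + x \in W.

(* Dependence of the family (P i) indexed by the i satisfying J; members are
   counted with multiplicity. *)
Definition dependent (R : realType) (I : finType) (n : nat)
    (J : I -> Prop) (P : I -> set 'rV[R]_n) : Prop :=
  exists T : {set I}, (forall i, i \in T -> J i) /\ degenerate P T.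

(* Main.v *)
(* Stratify hatX by the sets s of vanishing coordinates. Write f = sum_m a_m x^m.
   On the stratum of s, after rescaling a_m = b_m x^(e_m) by a torus point x, being
   singular becomes a system of linear equations on b; so the coefficients of the
   f with a singular point on the stratum are the image of (linear space) x (torus)
   under a monomial map, and only the dimension of this image matters.
   - If some monomial does not vanish on the stratum, the equations sum b_m = 0 and
     sum b_m m = 0 cut out a space of codimension larger than the rank of the
     exponents: the image is not dense.
   - Otherwise the equations say that each f_rho vanishes, that is
     sum_(m in A_rho) b_m = 0, where A_rho is the set of exponents whose convex hull
     is Delta_s^rho (up to translation). If l of the polytopes lie in a space of
     dimension l - 1, the image is again not dense.
   - If the polytopes are independent, Rado's theorem gives linearly independent
     vectors v_rho = sum_(m in A_rho) b_m m with sum_(m in A_rho) b_m = 0; this makes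
     the differential of the monomial map surjective at a point, so the image is
     dense and no open set of coefficients avoids it. *)
Require Import Defs.
From HB Require Import structures.
From mathcomp Require Import all_boot all_order all_algebra.
From mathcomp Require Import boolp classical_sets reals.
From mathcomp Require Import complex.
From mathcomp Require Import mpoly ring.

Set Implicit Arguments.
Unset Strict Implicit.
Unset Printing Implicit Defensive.
Import Order.TTheory GRing.Theory Num.Theory.
Local Open Scope ring_scope.

(** * Polynomials vanishing on a set, tested along curves *)

Section Vanishing.
Variable K : numFieldType.

(** The exceptional value allows curves that leave the torus at one parameter. Multiplying by X - s0
    removes it, and in characteristic zero 0, 1, 2, ... supply too many roots. *)
Lemma poly_eq0_cofinite (p : {poly K}) (s0 : K) :
  (forall s, s != s0 -> p.[s] = 0) -> p = 0.
Proof.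
move=> p0; set q := p * ('X - s0%:P).
suff /eqP : q = 0 by rewrite mulf_eq0 polyXsubC_eq0 orbF => /eqP.
have q0 s : q.[s] = 0.
  rewrite !hornerE; case: (eqVneq s s0) => [->|/p0 ->]; last by rewrite mul0r.
  by rewrite subrr mulr0.
apply/eqP; apply: contraT => qN0.
pose rs : seq K := [seq i%:R | i <- iota 0 (size q)].
have := @max_poly_roots K q rs qN0.
rewrite size_map size_iota ltnn; apply.
  by apply/allP => s _; apply/rootP.
by rewrite map_inj_uniq ?iota_uniq// => i j /eqP; rewrite eqr_nat => /eqP.
Qed.

Definition mcurve n (a : 'I_n -> {poly K}) (q : {mpoly K[n]}) : {poly K} :=
  mmap polyC a q.

Lemma horner_mcurve n (a : 'I_n -> {poly K}) q s :
  (mcurve a q).[s] = q.@[fun i => (a i).[s]].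
Proof.
rewrite /mcurve /mmap mevalE horner_sum; apply: eq_bigr => m _.
rewrite hornerM hornerC horner_prod; congr (_ * _).
by apply: eq_bigr => i _; rewrite horner_exp.
Qed.

(** Chain rule: the [q] that satisfy it include constants and variables and are stable under sums
    and products. *)
Lemma deriv_mcurve n (a : 'I_n -> {poly K}) q :
  (mcurve a q)^`() = \sum_i mcurve a q^`M(i) * (a i)^`().
Proof.
have mcD p r : mcurve a (p + r) = mcurve a p + mcurve a r by exact: mmapD.
have mcM p r : mcurve a (p * r) = mcurve a p * mcurve a r by exact: rmorphM.
pose chain p := (mcurve a p)^`() = \sum_i mcurve a p^`M(i) * (a i)^`().
have chainC c : chain c%:MP.
  rewrite /chain /mcurve mmapC derivC big1// => i _.
  by rewrite mderivC mmap0 mul0r.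
have chainM p r : chain p -> chain r -> chain (p * r).
  rewrite /chain mcM derivM => -> ->; rewrite mulr_suml mulr_sumr -big_split.
  apply: eq_bigr => i _; rewrite mderivM mcD !mcM mulrDl; congr (_ + _).
    by rewrite mulrAC.
  by rewrite mulrA.
elim/mpolyind: q => [|c m q _ _ IH]; first by rewrite -(mpolyC0 n); exact: (@chainC).
have {}IH : chain q by [].
have : chain (c *: 'X_[m]).
  rewrite -mul_mpolyC; apply: (@chainM); first exact: (@chainC).
  rewrite mpolyXE_id; elim/big_ind: _ => [|p r|i _].
  - by rewrite -mpolyC1; exact: (@chainC).
  - exact: (@chainM).
  elim: (m i) => [|k IHk]; first by rewrite expr0 -mpolyC1; exact: (@chainC).
  rewrite exprS; apply: (@chainM) => //.
  rewrite /chain /mcurve mmapX mmap1U (bigD1 i)//= big1 ?addr0 => [|j ji].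
    have -> : ('X_i : {mpoly K[n]})^`M(i) = 1%:MP.
      by rewrite mderivX mnm1E eqxx scale1r -{1}[U_(i)%MM]add0m addmK mpolyX0.
    by rewrite mmapC mul1r.
  by rewrite mderivX mnm1E eq_sym (negbTE ji) scale0r mmap0 mul0r.
rewrite /chain mcD derivD => ->; rewrite IH -big_split; apply: eq_bigr => i _.
by rewrite mderivD mcD mulrDl.
Qed.

Lemma msize_mderiv n (p : {mpoly K[n]}) i : (msize p^`M(i) <= (msize p).-1)%N.
Proof.
rewrite [X in (X <= _)%N]msizeE; apply/bigmax_leqP_seq => m mp _.
have : (m + U_(i))%MM \in msupp p.
  move: mp; rewrite !mcoeff_msupp mcoeff_deriv; apply: contraNN => /eqP ->.
  by rewrite mul0rn.
move=> /msize_mdeg_lt; rewrite mdegD mdeg1 addn1.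
by case: (msize p).
Qed.

Lemma mderiv_eq0_const n (p : {mpoly K[n]}) :
  (forall i, p^`M(i) = 0) -> p = (p@_0%MM)%:MP.
Proof.
move=> dp0; apply/mpolyP => m; rewrite mcoeffC.
case: (eqVneq m 0%MM) => [->|mN0]; first by rewrite mulr1.
rewrite mulr0; have [i mi] : exists i, m i != 0%N.
  apply/existsP; apply: contraT; rewrite negb_exists => /forallP m0.
  case/negP: mN0; apply/eqP/mnmP => i; rewrite mnm0E.
  by have := m0 i; rewrite negbK => /eqP.
have := mcoeff_deriv i (m - U_(i))%MM p.
rewrite dp0 mcoeff0 submK ?lep1mP// => /esym/eqP.
by rewrite mulrn_eq0 /= => /eqP.
Qed.

(** Induction on the size: the partial derivatives vanish on [Z] and are smaller, hence zero, so [q]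
    is a constant, and a point of [Z] shows that this constant is 0. *)
Lemma vanishing_ideal_eq0 n (Z : ('I_n -> K) -> Prop) :
  (exists v, Z v) ->
  (forall q : {mpoly K[n]}, (forall v, Z v -> q.@[v] = 0) ->
     forall i v, Z v -> (q^`M(i)).@[v] = 0) ->
  forall q : {mpoly K[n]}, (forall v, Z v -> q.@[v] = 0) -> q = 0.
Proof.
move=> [v0 Zv0] dZ q; have [N] := ubnP (msize q); elim: N q => // N IH q.
rewrite ltnS => szq q0; apply/eqP; apply: contraT => qN0.
have dq0 i : q^`M(i) = 0.
  apply: IH; last by move=> v Zv; apply: dZ.
  apply: leq_ltn_trans (msize_mderiv q i) _; apply: leq_trans szq.
  by rewrite prednK// lt0n msize_poly_eq0.
case/negP: qN0; have := q0 v0 Zv0.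
by rewrite (mderiv_eq0_const dq0) mevalC => ->; rewrite mpolyC0.
Qed.

(** Here [Z] is the whole space; differentiating along lines parallel to the axes shows that the
    partial derivatives vanish everywhere as well. *)
Lemma meval_eq0 n (q : {mpoly K[n]}) : (forall v, q.@[v] = 0) -> q = 0.
Proof.
move=> q0; apply: (@vanishing_ideal_eq0 n (fun=> True)) => //.
  by exists (fun=> 0).
move=> {q0} q q0 i v _.
pose a j : {poly K} := (v j)%:P + 'X *+ (j == i).
have aE s j : (a j).[s] = v j + s *+ (j == i) by rewrite !hornerE hornerMn hornerX.
have cz : mcurve a q = 0.
  apply: (@poly_eq0_cofinite _ 0) => s _; rewrite horner_mcurve.
  exact: q0.
have := deriv_mcurve a q; rewrite cz deriv0 (bigD1 i)//= big1 => [|j ji].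
  rewrite derivD derivC derivMn derivX eqxx add0r mulr1 addr0 => /esym c0.
  have := horner_mcurve a q^`M(i) 0; rewrite c0 horner0 => /esym <-.
  by apply: meval_eq => j; rewrite aE mul0rn addr0.
by rewrite derivD derivC derivMn (negbTE ji) addr0 mulr0.
Qed.

Lemma mpoly_neq0_meval n (q : {mpoly K[n]}) : q != 0 -> exists v, q.@[v] != 0.
Proof.
move=> qN0; apply: contrapT => q0; case/negP: qN0; apply/eqP/meval_eq0 => v.
by apply: contrapT => qv; apply: q0; exists v; apply/eqP.
Qed.

End Vanishing.

(** * Independent representatives of a family of subspaces *)

Section Rado.
Variables (K : fieldType) (V : vectType K).

(** Rado's condition for independent representatives; for lines spanned by vectors it amounts to
    linear independence of these vectors. *)
Definition hall (I : finType) (U : I -> {vspace V}) :=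
  forall T : {set I}, (#|T| <= \dim (\sum_(i in T) U i)%VS)%N.

(** Drop the second, respectively the first, vector from a basis of [U]. *)
Lemma two_hyperplanes (U : {vspace V}) : (1 < \dim U)%N ->
  exists H1 H2 : {vspace V}, [/\ (\dim H1 < \dim U)%N, (\dim H2 < \dim U)%N
    & (H1 + H2)%VS = U].
Proof.
move=> dU; have := size_tuple (vbasis U); have := span_basis (vbasisP U).
case: (tval _) => [|a [|b l]] /=; first by move=> _ e; rewrite -e in dU.
  by move=> _ e; rewrite -e in dU.
move=> spU sz; exists <<a :: l>>%VS, <<b :: l>>%VS; split.
- by rewrite -sz; apply: leq_ltn_trans (dim_span _) _.
- by rewrite -sz; apply: leq_ltn_trans (dim_span _) _.
rewrite -spU !span_cons; set A := <[a]>%VS; set B := <[b]>%VS; set L := <<l>>%VS.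
have [sA sB sL] : [/\ A <= A + (B + L), B <= A + (B + L) & L <= A + (B + L)]%VS.
  by split; rewrite ?addvSl// (subv_trans _ (addvSr _ _)) ?addvSl ?addvSr.
have [tA tB tL] : [/\ A <= A + L + (B + L), B <= A + L + (B + L)
    & L <= A + L + (B + L)]%VS.
  split; [|by rewrite (subv_trans _ (addvSr _ _)) ?addvSl..|];
  by rewrite (subv_trans _ (addvSl _ _)) ?addvSl ?addvSr.
apply/eqP; rewrite eqEsubv 2!subv_add (subv_add B) sA sB sL/=.
by rewrite subv_add tA subv_add tB tL.
Qed.

(* Rado's theorem for subspaces. A space of dimension at least 2 is the sum of two
   hyperplanes; by modularity of the dimension, Hall's condition survives
   shrinking it to one of them. *)
Lemma rado_subspaces (I : finType) (U : I -> {vspace V}) : hall U ->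
  exists2 v : I -> V, (forall i, v i \in U i) & hall (fun i => <[v i]>%VS).
Proof.
have [N] := ubnP (\sum_i \dim (U i))%N; elim: N U => // N IH U; rewrite ltnS => szU hU.
have [[i0 d0]|small] := pselect (exists i0, (1 < \dim (U i0))%N); last first.
  (* All dimensions are at most 1, and Hall's condition on singletons makes them equal to 1, so any
     nonzero vector spans. *)
  exists (fun i => vpick (U i)); first by move=> i; exact: memv_pick.
  move=> T; apply: leq_trans (hU T) _; apply/dimvS/subv_sumP => i iT.
  apply: subv_trans (sumv_sup i iT (subvv _)).
  rewrite -(geq_leqif (dimv_leqif_sup _)) ?dim_vline; last first.
    by rewrite -memvE memv_pick.
  apply: (@leq_trans 1); first by rewrite leqNgt; apply/negP => d; apply: small; exists i.
  by rewrite vpick0 lt0b -dimv_eq0 -lt0n; have := hU [set i]; rewrite cards1 big_set1.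
have [H1 [H2 [d1 d2 dH]]] := two_hyperplanes d0.
pose U' (H : {vspace V}) i := if i == i0 then H else U i.
have main H : (\dim H < \dim (U i0))%N -> (H <= U i0)%VS -> hall (U' H) ->
    exists2 v : I -> V, (forall i, v i \in U i) & hall (fun i => <[v i]>%VS).
  move=> dH' sH /IH [].
    apply: leq_trans szU; rewrite (bigD1 i0)//= [X in (_ < X)%N](bigD1 i0)//=.
    rewrite /U' eqxx -addSn leq_add// leq_sum// => i /negbTE ->.
    exact: leqnn.
  move=> v vU hv; exists v => // i; have := vU i; rewrite /U'.
  by case: eqP => // -> /(subvP sH).
(* A set violating the condition after shrinking must contain [i0]; it is recorded without [i0]. *)
have nhall H : ~ hall (U' H) -> exists2 T : {set I}, i0 \notin T &
    (\dim (H + \sum_(i in T) U i)%VS <= #|T|)%N.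
  move=> /existsNP [T /negP]; rewrite -ltnNge => dT.
  have i0T : i0 \in T.
    apply: contraLR dT => i0T; rewrite -leqNgt; apply: leq_trans (hU T) _.
    apply/dimvS/subv_sumP => i iT; apply: (sumv_sup i) => //.
    by rewrite /U'; case: eqP iT i0T => // -> ->.
  exists (T :\ i0); first by rewrite setD11.
  move: dT; rewrite [X in (_ < X)%N -> _](cardsD1 i0) i0T ltnS; apply: leq_trans.
  apply: dimvS; rewrite [X in (_ <= X)%VS](big_setD1 i0)//=.
  have -> : U' H i0 = H by rewrite /U' eqxx.
  apply: addvS => //; apply/subv_sumP => i iT; apply: (sumv_sup i) => //.
  by move: iT; rewrite in_setD1 /U' => /andP[/negbTE ->].
have [h1|/nhall [T1 i1 D1]] := pselect (hall (U' H1)).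
  by apply: (main H1) => //; rewrite -dH addvSl.
have [h2|/nhall [T2 i2 D2]] := pselect (hall (U' H2)).
  by apply: (main H2) => //; rewrite -dH addvSr.
(* X + Y contains the sum over [i0], T1 and T2, and the intersection contains the sum over T1 and T2
   in common, so dim X + dim Y exceeds #T1 + #T2, against [D1] and [D2]. *)
exfalso; set X := (H1 + _)%VS in D1; set Y := (H2 + _)%VS in D2.
have := dimv_sum_cap X Y; apply/eqP; rewrite neq_ltn; apply/orP; right.
apply: leq_ltn_trans (leq_add D1 D2) _; rewrite -cardsUI -addSn leq_add//; last first.
  apply: leq_trans (hU _) _; apply/dimvS/subv_sumP => i; rewrite inE => /andP[a b].
  rewrite subv_cap; apply/andP; split; apply: subv_trans (addvSr _ _).
    exact: (sumv_sup i).
  exact: (sumv_sup i).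
have := hU (i0 |: (T1 :|: T2)); rewrite cardsU1 inE negb_or i1 i2/= add1n => /leq_trans.
apply; apply/dimvS/subv_sumP => i; rewrite !inE => /or3P[/eqP ->|iT|iT].
- by rewrite -dH addvS// addvSl.
- by apply: subv_trans (addvSl _ _); apply: subv_trans (addvSr _ _); exact: (sumv_sup i).
- by apply: subv_trans (addvSr _ _); apply: subv_trans (addvSr _ _); exact: (sumv_sup i).
Qed.

End Rado.

(** * A polynomial relation on a monomial image of small dimension *)

Section Count.
Variable K : numFieldType.

Lemma finfun_linear_relation (S T : finType) (M : S -> T -> K) : (#|T| < #|S|)%N ->
  exists2 c : S -> K, (exists s, c s != 0) & forall t, \sum_s c s * M s t = 0.
Proof.
move=> lt_TS.
pose A : 'M[K]_(#|S|, #|T|) := \matrix_(i, j) M (enum_val i) (enum_val j).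
have /rowV0Pn [v /sub_kermxP vA /rV0Pn [i vi]] : kermx A != 0.
  rewrite -mxrank_eq0 mxrank_ker -lt0n subn_gt0.
  by apply: leq_ltn_trans lt_TS; exact: rank_leq_col.
exists (fun s => v 0 (enum_rank s)); first by exists (enum_val i); rewrite enum_valK.
move=> t; have /matrixP/(_ 0 (enum_rank t)) := vA; rewrite !mxE; apply: etrans.
rewrite (reindex (@enum_val S S)) /=; last by apply: onW_bij; exact: enum_val_bij.
by apply: eq_bigr => j _; rewrite !mxE !enum_rankK enum_valK.
Qed.

(** The [f l] index a maximal independent set of columns; the others depend on them over [K], and an
    integer is zero once its image in [K] is. *)
Lemma determining_coordinates (N n : nat) (E : 'I_N -> 'I_n -> int) :
  exists f : 'I_(\rank (\matrix_(j, i) (E j i)%:~R : 'M[K]_(N, n))) -> 'I_n,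
  forall z : 'I_N -> int, (forall l, \sum_j z j * E j (f l) = 0) ->
    forall i, \sum_j z j * E j i = 0.
Proof.
set M := \matrix_(j, i) _; rewrite -mxrank_tr; exists (maxrankfun M^T) => z z0 i.
have /submxP [D MD] : (M^T <= rowsub (maxrankfun M^T) M^T)%MS by rewrite eq_maxrowsub.
pose w : 'cV[K]_N := \col_j (z j)%:~R.
have w0 : rowsub (maxrankfun M^T) M^T *m w = 0.
  apply/colP => l; rewrite !mxE; under eq_bigr => j _ do
    rewrite !mxE mulrC -intrM.
  by rewrite -rmorph_sum /= z0.
have /colP/(_ i) : M^T *m w = 0 by rewrite MD -mulmxA w0 mulmx0.
rewrite !mxE; under eq_bigr => j _ do rewrite !mxE mulrC -intrM.
by rewrite -rmorph_sum => /eqP; rewrite intr_eq0 => /eqP.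
Qed.

Lemma prod_exprz_sum (I : finType) (x : K) (e : I -> int) : x != 0 ->
  \prod_i x ^ e i = x ^ (\sum_i e i).
Proof.
move=> x0; elim/big_rec2: _ => [|i y m _ ->]; first by rewrite expr0z.
by rewrite expfzDr.
Qed.

(** The left side is at most a constant times D^(k + q), and [D] is chosen above that constant. *)
Lemma power_gt_linear_powers (a b k q N : nat) : (k + q < N)%N ->
  exists D, ((a * D).+1 ^ k * (b * D).+1 ^ q < D ^ N)%N.
Proof.
move=> kqN; pose D := (a.+1 ^ k * b.+1 ^ q).+1; exists D.
have le c : ((c * D).+1 <= c.+1 * D)%N by rewrite mulSn -addn1 addnC leq_add2r.
have wexp u v e : (u <= v -> u ^ e <= v ^ e)%N by case: e => // e; rewrite leq_exp2r.
apply: leq_ltn_trans (leq_mul (wexp _ _ k (le a)) (wexp _ _ q (le b))) _.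
rewrite !expnMn mulnACA -expnD; apply: (@leq_trans (D ^ (k + q).+1)).
  by rewrite expnS ltn_pmul2r ?expn_gt0.
exact: leq_pexp2l.
Qed.

(* Counting: the D^N monomials of partial degrees < D in N variables pull back to
   the span of (linear in D)^k * (linear in D)^q functions, q being the rank of
   the exponents, since a combination of the exponents is determined by q of its
   coordinates. *)
Lemma monomial_image_relation (N n k : nat) (B : 'M[K]_(k, N)) (E : 'I_N -> 'I_n -> int) :
  (k + \rank (\matrix_(j, i) (E j i)%:~R : 'M[K]_(N, n)) < N)%N ->
  exists2 P : {mpoly K[N]}, P != 0 &
    forall (t : 'rV[K]_k) (x : 'I_n -> K), (forall i, x i != 0) ->
      P.@[fun j => (t *m B) 0 j * \prod_i x i ^ E j i] = 0.
Proof.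
move=> lt_kqN; have [f fE] := determining_coordinates E.
move: lt_kqN f fE; set q := \rank _ => lt_kqN f fE.
(* [C] is chosen so that the torus exponents of a pulled-back monomial are at most C D in absolute
   value; shifted by C D they become natural numbers. *)
pose C := (\sum_j \sum_i `|E j i|)%N.
have [D ltD] := power_gt_linear_powers N (2 * C) lt_kqN.
pose S := {ffun 'I_N -> 'I_D}.
pose lin (j : 'I_N) : {mpoly K[k]} := \sum_l B l j *: 'X_l.
pose p (a : S) : {mpoly K[k]} := \prod_j lin j ^+ a j.
pose expo (a : S) i : int := \sum_j (a j : nat)%:Z * E j i.
have expo_le a i : `|expo a i| <= (C * D)%N%:Z.
  apply: le_trans (ler_norm_sum _ _ _) _.
  rewrite /C big_distrl /= (big_morph Posz PoszD (erefl (Posz 0))).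
  apply: ler_sum => j _; rewrite -abszE lez_nat abszM mulnC leq_mul//.
    by rewrite (bigD1 i)//= leq_addr.
  by rewrite absz_nat ltnW.
pose code (a : S) i : nat := absz (expo a i + (C * D)%N%:Z).
have codeE a i : (code a i)%:Z = expo a i + (C * D)%N%:Z.
  rewrite /code gez0_abs//; have := expo_le a i; rewrite ler_norml => /andP[h _].
  by rewrite -lerBlDr sub0r.
have code_lt a i : (code a i < (2 * C * D).+1)%N.
  rewrite ltnS -lez_nat codeE -mulnA mul2n -addnn PoszD lerD2r.
  exact: le_trans (ler_norm _) (expo_le a i).
pose proj (a : S) : {ffun 'I_q -> 'I_(2 * C * D).+1} := [ffun l => Ordinal (code_lt a (f l))].
have projP a a' : proj a = proj a' -> expo a =1 expo a'.
  move=> /ffunP ea i; apply/eqP; rewrite -subr_eq0 -sumrB.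
  under eq_bigr => j _ do rewrite -mulrBl.
  apply/eqP/fE => l; under eq_bigr => j _ do rewrite mulrBl.
  rewrite sumrB; apply/eqP; rewrite subr_eq0; apply/eqP.
  have := ea l; rewrite !ffunE => /(congr1 val) /= /(congr1 Posz).
  by rewrite !codeE => /addIr.
pose mon (b : {ffun 'I_k -> 'I_(N * D).+1}) : 'X_{1..k} := [multinom (b l : nat) | l < k].
pose T := ({ffun 'I_k -> 'I_(N * D).+1} * {ffun 'I_q -> 'I_(2 * C * D).+1})%type.
have ltTS : (#|{: T}| < #|{: S}|)%N.
  by rewrite card_prod !card_ffun !card_ord.
(* One unknown per monomial of partial degrees below D; one equation per pattern of torus exponents
   and per monomial in t. *)
have [c [a0 ca0] cM] := finfun_linear_relation
  (fun (a : S) (bg : T) => (proj a == bg.2)%:R * (p a)@_(mon bg.1)) ltTS.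
pose ma (a : S) : 'X_{1..N} := [multinom (a j : nat) | j < N].
have ma_inj : injective ma.
  move=> a a' /mnmP aa'; apply/ffunP => j; apply/val_inj.
  by have := aa' j; rewrite !mnmE.
exists (\sum_a c a *: 'X_[ma a]).
  apply/eqP => /mpolyP/(_ (ma a0)); rewrite mcoeff0 raddf_sum /= (bigD1 a0)//= big1.
    by rewrite mcoeffZ mcoeffX eqxx mulr1 addr0 => /eqP; apply/negP.
  by move=> a aa0; rewrite mcoeffZ mcoeffX (inj_eq ma_inj) (negbTE aa0) mulr0.
move=> t x x0; pose tt l := t 0 l.
have linE j : (lin j).@[tt] = (t *m B) 0 j.
  rewrite !mxE raddf_sum /=; apply: eq_bigr => l _.
  by rewrite mevalZ mevalXU mulrC.
have p_hom a : p a \is (\sum_j a j).-homog.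
  rewrite /p; elim/big_ind2: _ => [|u u' v v'|j _]; first exact: dhomog1.
    exact: dhomogM.
  rewrite -[X in X.-homog]mul1n; apply: dhomogMn; rewrite /lin; apply: rpred_sum => l _.
  by apply: rpredZ; rewrite dhomogX /= mdeg1.
(* Monomials sharing their torus exponents cancel among themselves. The degree of [p a] is at most N
   D, so no monomial in t outside those counted by [T] occurs. *)
have group0 g : \sum_(a | proj a == g) c a *: p a = 0.
  apply/mpolyP => m; rewrite mcoeff0 raddf_sum /=.
  have [small|] := boolP [forall l, (m l < (N * D).+1)%N]; last first.
    rewrite negb_forall => /existsP[l]; rewrite -leqNgt => ml.
    apply: big1 => a _; rewrite mcoeffZ (dhomog_nemf_coeff (p_hom a)) ?mulr0//.
    rewrite neq_ltn; apply/orP; right; rewrite /= mdegE (bigD1 l)//=.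
    apply: leq_trans (leq_trans ml (leq_addr _ _)).
    rewrite ltnS -[X in (_ <= X * _)%N]card_ord -sum_nat_const leq_sum// => j _.
    exact: ltnW.
  move/forallP in small; pose b := [ffun l => Ordinal (small l)].
  have -> : m = mon b by apply/mnmP => l; rewrite mnmE ffunE.
  apply: etrans (cM (b, g)); rewrite [RHS](bigID (fun a => proj a == g)) /=.
  rewrite [X in _ = _ + X]big1 ?addr0.
    by apply: eq_bigr => a ->; rewrite mcoeffZ mul1r.
  by move=> a /negbTE ->; rewrite mul0r mulr0.
rewrite raddf_sum /= (partition_big proj xpredT)//= big1// => g _.
have [[a1 /eqP pa1]|none] := pselect (exists a, proj a == g); last first.
  by apply: big1 => a pa; case: none; exists a.
have termE a : proj a == g ->
    (c a *: 'X_[ma a]).@[fun j => (t *m B) 0 j * \prod_i x i ^ E j i] =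
    (c a *: p a).@[tt] * \prod_i x i ^ expo a1 i.
  move=> /eqP pa; rewrite !mevalZ -mulrA mevalX; congr (_ * _).
  transitivity (\prod_j ((lin j).@[tt] ^+ a j * (\prod_i x i ^ E j i) ^+ a j)).
    by apply: eq_bigr => j _; rewrite mnmE exprMn linE.
  rewrite rmorph_prod big_split /=; congr (_ * _).
    by apply: eq_bigr => j _; rewrite rmorphXn.
  under eq_bigr => j _ do rewrite -prodrXl.
  rewrite exchange_big; apply: eq_bigr => i _.
  have -> : expo a1 i = expo a i by apply: projP; rewrite pa.
  rewrite /expo -prod_exprz_sum//; apply: eq_bigr => j _.
  by rewrite exprnP exprz_exp mulrC.
rewrite (eq_bigr _ termE) -mulr_suml -raddf_sum /=.
by rewrite group0 meval0 mul0r.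
Qed.

End Count.

(** * Dominance of the map rescaling coefficients by a torus *)

Section Dominance.
Variables (K : numFieldType) (N n k : nat).
Variables (e : 'I_N -> 'X_{1..n}) (gr : 'I_N -> option 'I_k).

(** [gr] sorts the indices by the equation in which they occur, with [None] for those that occur in
    no equation. *)
Definition balanced (b : 'I_N -> K) :=
  forall c, \sum_(j | gr j == Some c) b j = 0.

(** Row [c] is the gradient, in logarithmic coordinates at x = 1, of the sum of the terms b_j
    x^(e_j) of group [c]. *)
Definition log_gradient (b : 'I_N -> K) : 'M[K]_(k, n) :=
  \matrix_(c, i) \sum_(j | gr j == Some c) b j * (e j i)%:R.

Definition torus_scale (b : 'I_N -> K) (x : 'I_n -> K) (j : 'I_N) : K :=
  b j * \prod_i x i ^+ e j i.

Section Tangent.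
Variable q : {mpoly K[N]}.
Hypothesis q0 : forall b x, balanced b -> (forall i, x i != 0) ->
  q.@[torus_scale b x] = 0.
Variables (b : 'I_N -> K) (x : 'I_n -> K).
Hypotheses (bal_b : balanced b) (x0 : forall i, x i != 0).

(** The partial derivative in b_j of [q] composed with [torus_scale]. *)
Let g j := (q^`M(j)).@[torus_scale b x] * \prod_i x i ^+ e j i.

(** Differentiate at s = 0 along b + s beta, which stays balanced. *)
Lemma tangent_coefficient (beta : 'I_N -> K) : balanced beta ->
  \sum_j g j * beta j = 0.
Proof.
move=> bal_beta.
pose a j : {poly K} := ((b j)%:P + (beta j)%:P * 'X) * (\prod_i x i ^+ e j i)%:P.
have aE s : (fun j => (a j).[s]) = torus_scale (fun j => b j + beta j * s) x.
  by apply/funext => j; rewrite /torus_scale !hornerE.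
have cz : mcurve a q = 0.
  apply: (@poly_eq0_cofinite _ _ 0) => s _; rewrite horner_mcurve aE; apply: q0 => // c.
  by rewrite big_split /= -mulr_suml bal_b bal_beta mul0r addr0.
have := deriv_mcurve a q; rewrite cz deriv0 => /(congr1 (fun p => p.[0])).
rewrite horner0 horner_sum => /esym; apply: etrans; apply: eq_bigr => j _.
rewrite hornerM horner_mcurve aE /g -mulrA.
have -> : torus_scale (fun j => b j + beta j * 0) x = torus_scale b x.
  by congr torus_scale; apply/funext => i; rewrite mulr0 addr0.
congr (_ * _); rewrite /a !derivE !hornerE /=.
by rewrite mulrC.
Qed.

(** Differentiate at s = 0 along the curve multiplying the coordinate [i0] by 1 + s; it leaves the
    torus only at s = -1. *)
Lemma tangent_torus i0 : \sum_j g j * (b j * (e j i0)%:R) = 0.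
Proof.
pose a j : {poly K} := (torus_scale b x j)%:P * (1 + 'X) ^+ e j i0.
have aE s : (fun j => (a j).[s]) =
    torus_scale b (fun i => x i * (if i == i0 then 1 + s else 1)).
  apply/funext => j; rewrite /torus_scale /a hornerM hornerC horner_exp !hornerE.
  rewrite -mulrA; congr (_ * _).
  under [RHS]eq_bigr => i _ do rewrite exprMn.
  rewrite big_split /=; congr (_ * _); rewrite (bigD1 i0)//= eqxx big1 ?mulr1//.
  by move=> i /negbTE ->; rewrite expr1n.
have cz : mcurve a q = 0.
  apply: (@poly_eq0_cofinite _ _ (-1)) => s sN1; rewrite horner_mcurve aE; apply: q0 => // i.
  rewrite mulf_neq0//; case: ifP => _; last exact: oner_neq0.
  by rewrite addrC addr_eq0.
have := deriv_mcurve a q; rewrite cz deriv0 => /(congr1 (fun p => p.[0])).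
rewrite horner0 horner_sum => /esym; apply: etrans; apply: eq_bigr => j _.
rewrite hornerM horner_mcurve aE /g -mulrA.
have -> : torus_scale b (fun i => x i * (if i == i0 then 1 + 0 else 1)) = torus_scale b x.
  by congr torus_scale; apply/funext => i; rewrite addr0; case: ifP; rewrite mulr1.
congr (_ * _); rewrite /a derivM derivC mul0r add0r deriv_exp !derivE add0r mul1r.
rewrite hornerM hornerC hornerMn horner_exp !hornerE ?addr0 expr1n /torus_scale.
by rewrite /= [_ * b j]mulrC.
Qed.

(** Orthogonality to the balanced vectors makes [g] zero outside the groups and constant on each
    group. The vector of these constants is killed by [log_gradient b], whose rows are independent,
    so it is zero. *)
Lemma gradient_vanishes (W : 'M[K]_(n, k)) : log_gradient b *m W \in unitmx ->
  forall j, (q^`M(j)).@[torus_scale b x] = 0.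
Proof.
move=> Wu.
have g_none j : gr j = None -> g j = 0.
  move=> jN; have := @tangent_coefficient (fun i => (i == j)%:R).
  rewrite (bigD1 j)//= eqxx mulr1 big1 ?addr0 => [|i /negbTE ->]; last by rewrite mulr0.
  by apply=> c; apply: big1 => i ic; case: (i =P j) ic => // ->; rewrite jN.
have g_same j j' : gr j = gr j' -> g j = g j'.
  move=> jj'; apply/eqP; rewrite -subr_eq0; apply/eqP.
  have := @tangent_coefficient (fun i => (i == j)%:R - (i == j')%:R).
  have pick f i0 : \sum_i f i * (i == i0)%:R = f i0 :> K.
    rewrite (bigD1 i0)//= eqxx mulr1 big1 ?addr0// => i /negbTE ->.
    by rewrite mulr0.
  under eq_bigr => i _ do rewrite mulrBr.
  rewrite sumrB !pick; apply=> c; rewrite sumrB.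
  rewrite !(big_mkcond (fun i => gr i == Some c)) /=.
  have pick2 i0 : \sum_i (if gr i == Some c then (i == i0)%:R else 0) =
      (gr i0 == Some c)%:R :> K.
    rewrite (bigD1 i0)//= eqxx big1 ?addr0; first by case: ifP.
    by move=> i /negbTE ->; case: ifP.
  by rewrite !pick2 jj' subrr.
(* An empty group gets the default value 0. *)
pose lam : 'rV[K]_k := \row_c (if [pick j | gr j == Some c] is Some j then g j else 0).
have g_lam j c : gr j = Some c -> g j = lam 0 c.
  rewrite mxE => jc; case: pickP => [i /eqP ic|/(_ j)]; last by rewrite jc eqxx.
  by apply: g_same; rewrite jc ic.
have lam0 : lam = 0.
  suff lam_grad : lam *m log_gradient b = 0.
    by rewrite -[lam]mulmx1 -(mulmxV Wu) mulmxA mulmxA lam_grad !mul0mx.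
  apply/rowP => i; rewrite !mxE -[RHS](tangent_torus i).
  under eq_bigr => c _ do rewrite [log_gradient _ _ _]mxE big_mkcond mulr_sumr.
  rewrite exchange_big; apply: eq_bigr => j _ /=.
  case jc : (gr j) => [c|]; last by rewrite g_none// mul0r big1// => c _; rewrite mulr0.
  rewrite (bigD1 c)//= eqxx big1 ?addr0 => [|c' cc']; first by rewrite (g_lam _ _ jc).
  rewrite ifN ?mulr0//; apply: contra cc' => /eqP[->]//.
move=> j; have gj0 : g j = 0.
  by case jc : (gr j) => [c|]; [rewrite (g_lam _ _ jc) lam0 mxE|exact: g_none].
move/eqP: gj0; rewrite mulf_eq0 => /orP[/eqP//|].
rewrite (negbTE (_ : \prod_i _ != 0))//; apply/prodf_neq0 => i _.
by rewrite expf_neq0.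
Qed.
End Tangent.

(* The map (b, x) |-> torus_scale b x is dominant because its differential is
   onto where [log_gradient b] has full rank, which is a nonempty open condition
   on b; a polynomial of least degree vanishing on the image would therefore have
   all its partial derivatives vanishing there too. *)
Lemma torus_scale_dense (b0 : 'I_N -> K) (W : 'M[K]_(n, k)) :
  balanced b0 -> log_gradient b0 *m W = 1%:M ->
  forall q : {mpoly K[N]},
    (forall b x, balanced b -> (forall i, x i != 0) -> q.@[torus_scale b x] = 0) ->
    q = 0.
Proof.
move=> bal0 W0 q q0.
pose Z v := exists b x, [/\ balanced b, forall i, x i != 0 & v = torus_scale b x].
apply: (@vanishing_ideal_eq0 K N Z); last by move=> v [b [x [bb x0 ->]]]; exact: q0.
  exists (torus_scale b0 (fun=> 1)), b0, (fun=> 1); split=> // i; exact: oner_neq0.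
move=> {q0}q q0 j v [b [x [bb x0 ->]]].
(* The segment goes from [b0] at s = 0, where the gradient has full rank, to the given [b] at s =
   1. *)
pose bs s i := b0 i + s * (b i - b0 i).
have bal_s s : balanced (bs s).
  by move=> c; rewrite big_split -mulr_sumr sumrB /= bal0 bb subrr mulr0 addr0.
have grad_s s : log_gradient (bs s) *m W =
    (1 - s) *: 1%:M + s *: (log_gradient b *m W).
  rewrite -W0 !scalemxAl -mulmxDl; congr (_ *m _); apply/matrixP => c i.
  rewrite !mxE !mulr_sumr -big_split; apply: eq_bigr => l _ /=.
  by rewrite /bs; ring.
pose D : {poly K} := \det ((1 - 'X)%:M + 'X *: map_mx polyC (log_gradient b *m W)).
have DE s : D.[s] = \det (log_gradient (bs s) *m W).
  rewrite -[D.[s]]/(horner_eval s D) -det_map_mx grad_s; congr (\det _).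
  rewrite map_mxD map_scalar_mx map_mxZ /= /horner_eval !hornerE scalemx1.
  by congr (_ + _ *: _); apply/matrixP => c c'; rewrite 2!mxE /horner_eval hornerC.
pose a i : {poly K} := ((b0 i)%:P + (b i - b0 i)%:P * 'X) * (\prod_l x l ^+ e i l)%:P.
have aE s : (fun i => (a i).[s]) = torus_scale (bs s) x.
  by apply/funext => i; rewrite /torus_scale !hornerE /bs [s * _]mulrC.
(* Where [D] is nonzero the derivative of [q] vanishes. Since [D] is 1 at s = 0, the other factor is
   the zero polynomial, and s = 1 gives the claim. *)
have /eqP : mcurve a q^`M(j) * D = 0.
  apply: (@poly_eq0_cofinite _ _ 0) => s _; rewrite hornerM horner_mcurve aE DE.
  have [u|] := boolP (log_gradient (bs s) *m W \in unitmx).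
    rewrite (gradient_vanishes _ _ _ u) ?mul0r// => b' x' bb' x0'.
    by apply: q0; exists b', x'.
  by rewrite unitmxE unitfE negbK => /eqP ->; rewrite mulr0.
rewrite mulf_eq0 => /orP[/eqP c0|/eqP D0].
  have := horner_mcurve a q^`M(j) 1; rewrite c0 horner0 aE => ->.
  by congr meval; congr torus_scale; apply/funext => i; rewrite /bs; ring.
have := DE 0; rewrite D0 horner0 grad_s subr0 scale1r scale0r addr0 det1 => /esym/eqP.
by rewrite oner_eq0.
Qed.

End Dominance.

(** * Primitive generators, rays of cones and minimal cones *)

Section Fan.
Variable d : nat.
Implicit Types (u v w : 'rV[int]_d) (F : fan d).

Lemma pairing_sumr (K : comPzRingType) (I : finType) (P : pred I) (m : 'rV[K]_d)
    (c : I -> K) (v : I -> 'rV[K]_d) :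
  pairing m (\sum_(i | P i) c i *: v i) = \sum_(i | P i) c i * pairing m (v i).
Proof.
rewrite /pairing; under eq_bigr => j _ do rewrite summxE mulr_sumr.
rewrite exchange_big; apply: eq_bigr => i _; rewrite mulr_sumr.
by apply: eq_bigr => j _; rewrite mxE mulrCA.
Qed.

Lemma pairing_intr (K : pzRingType) (m v : 'rV[int]_d) :
  pairing (map_mx intr m) (map_mx intr v) = (pairing m v)%:~R :> K.
Proof.
by rewrite /pairing rmorph_sum; apply: eq_bigr => j _; rewrite !mxE rmorphM.
Qed.

Lemma gen_in_cone r (u : 'I_r -> 'rV[int]_d) (s : {set 'I_r}) i : i \in s ->
  cone_of u s (map_mx intr (u i)).
Proof.
move=> is_; exists (fun j => (j == i)%:R); split=> [j|]; first exact: ler0n.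
rewrite (bigD1 i)//= eqxx scale1r big1 ?addr0// => j /andP[_ /negbTE ->].
by rewrite scale0r.
Qed.

(** By coprimality [b] divides every coordinate of [u]. With numerator and denominator in the role
    of [b], this excludes proportional primitive vectors. *)
Lemma primitive_dvd u v (a b : int) : primitive u -> 0 <= b -> coprimez b a ->
  b *: v = a *: u -> b = 1.
Proof.
move=> [_ pu] b0 cop e.
suff ue : u = (absz b)%:Z *: (\row_l divz (u 0 l) b).
  by rewrite -(gez0_abs b0) (pu _ _ ue).
apply/rowP => l; rewrite gez0_abs// !mxE mulrC divzK// -(Gauss_dvdzr _ cop).
apply/dvdzP; exists (v 0 l).
by move/rowP/(_ l): e; rewrite !mxE => <-; rewrite mulrC.
Qed.

Lemma primitive_proportional u v (x : rat) : primitive u -> primitive v -> 0 <= x ->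
  map_mx intr v = x *: map_mx intr u -> v = u.
Proof.
move=> pu pv x0 e.
have e' : denq x *: v = numq x *: u.
  apply/rowP => l; apply: (@intr_inj rat).
  move/rowP/(_ l): e; rewrite !mxE !rmorphM/= => ->.
  by rewrite mulrA -[X in _ * X * _ = _]divq_num_den mulrCA mulfV ?mulr1// intr_eq0 denq_eq0.
have cop : coprimez (denq x) (numq x) by rewrite coprimezE coprime_sym coprime_num_den.
have den1 := primitive_dvd pu (denq_ge0 x) cop e'.
have num1 : numq x = 1.
  by apply: (primitive_dvd pv _ _ (esym e')); rewrite ?numq_ge0// coprimez_sym.
by move: e'; rewrite den1 num1 !scale1r.
Qed.

(** The form cutting out the common face of the cone and the ray vanishes on ray [i], hence on a
    generator [j] of [s] used to write it. Then ray [j] lies on ray [i], and primitivity identifies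
    them. *)
Lemma ray_in_cone F (s : {set 'I_(nrays F)}) i : s \in cones F ->
  cone_of (@ray d F) s (map_mx intr (ray i)) -> i \in s.
Proof.
move=> sF is_; have [m [m0 cutE]] := cone_inter sF (ray_cone i).
have mi : pairing m (map_mx intr (ray i)) = 0.
  have : (cone_of (@ray d F) s `&` cone_of (@ray d F) [set i])%classic (map_mx intr (ray i)).
    by split=> //; apply: gen_in_cone; rewrite inE.
  by rewrite cutE => -[].
have [c [c0 ci]] := is_.
have [j js cj] : exists2 j, j \in s & c j != 0.
  apply: contrapT => nc; have [/eqP ri0 _] := ray_primitive i; apply: ri0.
  have : map_mx intr (ray i) = 0 :> 'rV[rat]_d.
    rewrite ci big1// => j js; suff -> : c j = 0 by rewrite scale0r.
    by apply: contrapT => /eqP cj; apply: nc; exists j.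
  by move/rowP => e; apply/rowP => l; have /eqP := e l; rewrite !mxE intr_eq0 => /eqP.
have mj : pairing m (map_mx intr (ray j)) = 0.
  move: mi; rewrite ci pairing_sumr => /eqP; rewrite psumr_eq0; last first.
    by move=> k ks; rewrite mulr_ge0//; apply: m0; exact: gen_in_cone.
  by move=> /allP/(_ j); rewrite mem_index_enum js mulf_eq0 (negbTE cj) => /(_ isT)/eqP.
have [_ [a [a0]]] : (cone_of (@ray d F) s `&` cone_of (@ray d F) [set i])%classic
    (map_mx intr (ray j)).
  by rewrite cutE; split=> //; exact: gen_in_cone.
rewrite big_set1 => e; suff <- : j = i by [].
exact/ray_inj/(primitive_proportional (ray_primitive i) (ray_primitive j) (a0 i) e).
Qed.

(* A set s of rays of a non-simplicial cone need not span a face: its stratum is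
   then controlled by the smallest cone t containing it. *)
Lemma minimal_cone F (s t0 : {set 'I_(nrays F)}) : t0 \in cones F -> s \subset t0 ->
  exists t, [/\ t \in cones F, s \subset t & forall m : 'rV[int]_d,
    (forall i, i \in t -> 0 <= pairing m (ray i)) ->
    (forall i, i \in s -> pairing m (ray i) = 0) ->
    forall i, i \in t -> pairing m (ray i) = 0].
Proof.
move=> t0F st0; pose P t := (t \in cones F) && (s \subset t).
have Pt0 : P t0 by rewrite /P t0F.
case: (@arg_minnP _ t0 P (fun t => #|t|) Pt0) => t /andP[tF st] tmin.
exists t; split=> // m mt ms i it.
pose mq : 'rV[rat]_d := map_mx intr m.
have mq0 (v : 'rV[rat]_d) : cone_of (@ray d F) t v -> 0 <= pairing mq v.
  move=> [c [c0 ->]]; rewrite pairing_sumr; apply: sumr_ge0 => j jt.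
  by rewrite mulr_ge0// pairing_intr ler0z mt.
(* The face cut out by [m] is a cone of the fan whose rays lie between [s] and [t]; minimality makes
   it all of [t]. *)
have [t' t'F t'E] := cone_faces tF (ex_intro _ mq (conj mq0 (erefl _))).
have t't : t' \subset t.
  apply/fintype.subsetP => j jt'; apply: ray_in_cone => //.
  by have := gen_in_cone (@ray d F) jt'; rewrite t'E => -[].
have st' : s \subset t'.
  apply/fintype.subsetP => j js; apply: ray_in_cone => //; rewrite t'E; split.
    by apply: gen_in_cone; exact: (fintype.subsetP st).
  by rewrite pairing_intr ms.
have tt' : t' = t.
  by apply/eqP; rewrite eqEcard t't tmin// /P t'F.
have := gen_in_cone (@ray d F) it; rewrite -{1}tt' t'E => -[_].
by rewrite pairing_intr => /eqP; rewrite intr_eq0 => /eqP.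
Qed.

End Fan.

(** * Evaluation and derivatives of combinations of monomials *)

Section MonomialSums.
Variables (K : numFieldType) (n N : nat) (mon : 'I_N -> 'X_{1..n}).
Implicit Types (a : 'I_N -> K).

Definition msum a : {mpoly K[n]} := \sum_j a j *: 'X_[mon j].

Lemma meval_msum a v : (msum a).@[v] = \sum_j a j * \prod_i v i ^+ mon j i.
Proof.
by rewrite raddf_sum; apply: eq_bigr => j _; rewrite /= mevalZ mevalX.
Qed.

Lemma mcoeff_msum a m : (msum a)@_m = \sum_j a j * (mon j == m)%:R.
Proof.
by rewrite raddf_sum; apply: eq_bigr => j _; rewrite /= mcoeffZ mcoeffX.
Qed.

Lemma mcoeff_msum_mon a j : injective mon -> (msum a)@_(mon j) = a j.
Proof.
move=> mon_inj; rewrite mcoeff_msum (bigD1 j)//= eqxx mulr1 big1 ?addr0// => i ij.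
by rewrite (inj_eq mon_inj) (negbTE ij) mulr0.
Qed.

Lemma mderiv_msum a i v :
  (msum a)^`M(i).@[v] = \sum_j a j * ((mon j i)%:R * \prod_l v l ^+ (mon j - U_(i))%MM l).
Proof.
rewrite /msum (linear_sum (mderiv i)) raddf_sum; apply: eq_bigr => j _ /=.
by rewrite mderivZ mderivX !mevalZ mevalX.
Qed.

Lemma euler_msum a i v :
  v i * (msum a)^`M(i).@[v] = \sum_j (a j * (mon j i)%:R) * \prod_l v l ^+ mon j l.
Proof.
rewrite mderiv_msum mulr_sumr; apply: eq_bigr => j _; move: (mon j) => m.
(* When m_i = 0 the exponent subtraction truncates, but the factor m_i kills the term. *)
case: (posnP (m i)) => [->|mi]; first by rewrite mul0r !mulr0 mul0r.
rewrite (bigD1 i)//= [in RHS](bigD1 i)//= mnmBE mnm1E eqxx subn1.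
under [in LHS]eq_bigr => l li do rewrite mnmBE mnm1E eq_sym (negbTE li) subn0.
have -> : v i ^+ m i = v i * v i ^+ (m i).-1 by rewrite -exprS prednK.
ring.
Qed.

End MonomialSums.

(** * Homogeneous components along a line through the origin *)

Section Homogeneous.
Variable K : numFieldType.

(** The value at [c] of the component of degree [e] is the coefficient of x^e in p(x c). *)
Lemma pihomog_ray n (p : {mpoly K[n]}) (c : 'I_n -> K) e :
  (forall x, x != 0 -> p.@[fun i => x * c i] = 0) -> (pihomog mdeg e p).@[c] = 0.
Proof.
move=> pc; pose a i : {poly K} := (c i)%:P * 'X.
have /(congr1 (fun q : {poly K} => q`_e)) : mcurve a p = 0.
  apply: (@poly_eq0_cofinite _ _ 0) => x x0; rewrite horner_mcurve -[RHS](pc x x0).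
  by apply: meval_eq => i; rewrite !hornerE mulrC.
rewrite coef0 => <-; rewrite pihomogE raddf_sum /mcurve /mmap coef_sum big_mkcond /=.
apply: eq_bigr => m _; rewrite mevalZ mevalX coefCM /mmap1 /a.
under [in RHS]eq_bigr => i _ do rewrite exprMn.
rewrite big_split /= prodrXr -mdegE.
have -> : \prod_i (c i)%:P ^+ m i = (\prod_i c i ^+ m i)%:P.
  by rewrite rmorph_prod; apply: eq_bigr => i _; rewrite rmorphXn.
by rewrite coefCM coefXn eq_sym; case: eqP => _; rewrite ?mulr1// !mulr0.
Qed.
End Homogeneous.

(** * Generality expressed in monomial coefficients *)

Section System.
Variables (R : realType) (d : nat) (F : fan d) (L : linear_system R F).
Local Notation C := (complex R).

Lemma monomial_system_basis : monomial_system L ->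
  exists N (mon : 'I_N -> 'X_{1..nrays F}), injective mon /\
    forall f, ls_space L f <-> exists a : 'I_N -> C, f = msum mon a.
Proof.
move=> [ms msP]; pose A := undup ms.
pose mon (j : 'I_(size A)) := tnth (in_tuple A) j.
have mon_inj : injective mon by apply/tuple_uniqP; exact: undup_uniq.
exists (size A), mon; split=> //.
have sumE (a : 'X_{1..nrays F} -> C) : \sum_(m <- ms) a m *: 'X_[m] =
    msum mon (fun j => (count_mem (mon j) ms)%:R * a (mon j)) :> cox R F.
  rewrite -big_undup_iterop_count /= -/A (big_tnth _ _ A) /msum.
  apply: eq_bigr => j _; rewrite -[tnth _ _]/(mon j) mulr_natl -scalerMnl.
  by rewrite [RHS]/GRing.natmul.
move=> f; rewrite msP; split=> [[a ->]|[a ->]]; first by eexists; exact: sumE.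
(* Every occurrence of a repeated monomial receives an equal share of its coefficient. *)
exists (fun m => (count_mem m ms)%:R^-1 * \sum_j a j * (mon j == m)%:R).
rewrite sumE; apply: eq_bigr => j _; congr (_ *: _).
rewrite (bigD1 j)//= eqxx mulr1 big1 ?addr0 => [|i ij]; last first.
  by rewrite (inj_eq mon_inj) (negbTE ij) mulr0.
rewrite mulrA mulfV ?mul1r// pnatr_eq0 -lt0n -has_count has_pred1.
by rewrite -mem_undup; exact: mem_tnth.
Qed.


Variables (N : nat) (mon : 'I_N -> 'X_{1..nrays F}).
Hypothesis mon_inj : injective mon.
Hypothesis basisP : forall f, ls_space L f <-> exists a : 'I_N -> C, f = msum mon a.

Lemma msum_inj a b : msum mon a = msum mon b :> cox R F -> a = b.
Proof.
move=> ab; apply/funext => j.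
by rewrite -(mcoeff_msum_mon a j mon_inj) ab mcoeff_msum_mon.
Qed.

Lemma ls_elt_inj c c' : ls_elt c = ls_elt c' :> cox R F -> c = c' :> 'rV[C]_(ls_dim L).+1.
Proof.
move=> /eqP; rewrite -subr_eq0 -sumrB => /eqP e; apply/eqP; rewrite -subr_eq0; apply/eqP.
apply: ls_free; rewrite -[RHS]e; apply: eq_bigr => j _.
by rewrite !mxE scalerBl.
Qed.

Lemma coordinate_change : exists (S : 'M[C]_(N, (ls_dim L).+1)) (T : 'M[C]_((ls_dim L).+1, N)),
  [/\ forall a : 'rV[C]_N, ls_elt (a *m S) = msum mon (a 0) :> cox R F,
      forall c : 'rV[C]_(ls_dim L).+1, ls_elt c = msum mon ((c *m T) 0) :> cox R F &
      forall c : 'rV[C]_(ls_dim L).+1, c *m T *m S = c].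
Proof.
have basisX j : exists c : 'rV[C]_(ls_dim L).+1, 'X_[mon j] = ls_elt c :> cox R F.
  have [_ ] := basisP 'X_[mon j]; case.
    exists (fun i => (i == j)%:R); rewrite /msum (bigD1 j)//= eqxx scale1r big1 ?addr0//.
    by move=> i /negbTE ->; rewrite scale0r.
  by move=> c ->; exists c.
have {basisX}[s sP] := choice basisX.
have basisT j : exists a : 'I_N -> C, ls_basis (l := L) j = msum mon a.
  apply/basisP; exists (delta_mx 0 j); rewrite /ls_elt (bigD1 j)//= mxE !eqxx scale1r.
  by rewrite big1 ?addr0// => i /negbTE ij; rewrite mxE ij andbF scale0r.
have {basisT}[t tP] := choice basisT.
have SE (a : 'rV[C]_N) : ls_elt (a *m \matrix_(j, i) s j 0 i) = msum mon (a 0) :> cox R F.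
  rewrite /ls_elt; under eq_bigr => i _ do rewrite mxE scaler_suml.
  rewrite exchange_big; apply: eq_bigr => j _; rewrite sP /ls_elt scaler_sumr.
  by apply: eq_bigr => i _; rewrite mxE scalerA.
have TE (c : 'rV[C]_(ls_dim L).+1) :
    ls_elt c = msum mon ((c *m \matrix_(j, i) t j i) 0) :> cox R F.
  rewrite /msum; under eq_bigr => i _ do rewrite mxE scaler_suml.
  rewrite exchange_big; apply: eq_bigr => j _; rewrite tP /msum scaler_sumr.
  by apply: eq_bigr => i _; rewrite mxE scalerA.
exists (\matrix_(j, i) s j 0 i), (\matrix_(j, i) t j i); split=> // c.
by apply: ls_elt_inj; rewrite SE -TE.
Qed.

Lemma meval_linear_change (k l : nat) (M : 'M[C]_(k, l)) (q : {mpoly C[l]}) (v : 'rV[C]_k) :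
  (q \mPo [tuple \sum_j M j i *: 'X_j | i < l]).@[v 0] = q.@[(v *m M) 0].
Proof.
rewrite comp_mpoly_meval; apply: meval_eq => i; rewrite tnth_mktuple mxE raddf_sum.
by apply: eq_bigr => j _; rewrite /= mevalZ mevalXU mulrC.
Qed.

(** Replaces an open subset of projective space by the nonvanishing of a single polynomial, so that
    finitely many conditions combine by a product and density can be used against them. *)
Lemma generalP (Q : cox R F -> Prop) :
  (forall x f, x != 0 -> Q f -> Q (x *: f)) ->
  general L Q <-> exists2 P : {mpoly C[N]}, P != 0 &
    forall a, P.@[a] != 0 -> Q (msum mon a).
Proof.
move=> Qscale; have [S [T [SE TE STK]]] := coordinate_change; split.
  move=> [U [[D [Dhom DU]] [c0 c0N0 Uc0] UQ]].
  have [q Dq qc0] := (DU c0 c0N0).1 Uc0; have /rV0Pn [i0 c0i] := c0N0.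
  (* The factor ['X_i0] forces the coordinate vector to be nonzero where [P] is. *)
  pose P := (q * 'X_i0) \mPo [tuple \sum_j S j i *: 'X_j | i < (ls_dim L).+1].
  have PE (a : 'rV[C]_N) : P.@[a 0] = q.@[(a *m S) 0] * (a *m S) 0 i0.
    by rewrite meval_linear_change mevalM mevalXU.
  exists P; first apply/eqP => P0.
    have := PE (c0 *m T); rewrite STK P0 meval0 => /esym/eqP.
    by rewrite mulf_eq0 (negbTE qc0) (negbTE c0i).
  move=> a; have aE : (\row_j a j) 0 = a by apply/funext => j; rewrite mxE.
  rewrite -aE PE mulf_eq0 negb_or => /andP[qa ai]; rewrite -SE.
  have cN0 : (\row_j a j) *m S != 0 by apply/rV0Pn; exists i0.
  by apply: UQ => //; apply/DU => //; exists q.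
move=> [P PN0 PQ].
pose P' := P \mPo [tuple \sum_j T j i *: 'X_j | i < N].
have P'E (c : 'rV[C]_(ls_dim L).+1) : P'.@[c 0] = P.@[(c *m T) 0].
  exact: meval_linear_change.
(* [P'] need not be homogeneous: the open set is where some homogeneous component is nonzero. There
   [P'] is nonzero at some multiple of c, and [Q] is invariant under scaling. *)
exists (fun c => exists e, (pihomog mdeg e P').@[c 0] != 0); split.
- exists (fun q => exists e, q = pihomog mdeg e P'); split.
    by move=> q [e ->]; exists e; exact: pihomogP.
  move=> c _; split=> [[e ce]|[q [e ->] ce]]; last by exists e.
  by exists (pihomog mdeg e P') => //; exists e.
- have P'N0 : P' != 0.
    have [a Pa] := mpoly_neq0_meval PN0; apply/eqP => P'0.
    have aE : (\row_j a j) 0 = a by apply/funext => j; rewrite mxE.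
    have := P'E ((\row_j a j) *m S); rewrite P'0 meval0.
    have -> : ((\row_j a j) *m S *m T) 0 = a.
      by apply: msum_inj; rewrite -TE SE aE.
    by move=> /esym/eqP; rewrite (negbTE Pa).
  have XN0 : 'X_ord0 != 0 :> {mpoly C[(ls_dim L).+1]} by rewrite -msupp_eq0 msuppX.
  have [v] := mpoly_neq0_meval (mulf_neq0 P'N0 XN0).
  rewrite mevalM mevalXU mulf_eq0 negb_or => /andP[Pv v0].
  have vE : (\row_j v j) 0 = v by apply/funext => j; rewrite mxE.
  exists (\row_j v j); first by apply/rV0Pn; exists ord0; rewrite vE.
  rewrite vE; apply: contrapT => none; case/negP: Pv.
  have -> := pihomog_partitionE (leqnn (mmeasure mdeg P')).
  rewrite raddf_sum big1//= => e _.
  by apply: contrapT => /eqP ne; apply: none; exists e.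
move=> c cN0 [e ce].
have [x x0 Px] : exists2 x : C, x != 0 & P'.@[(x *: c) 0] != 0.
  apply: contrapT => none; case/negP: ce; apply/eqP/pihomog_ray => x x0.
  apply: contrapT => /eqP ne; apply: none; exists x => //; move: ne.
  by congr (~~ (_ == _)); apply: meval_eq => i; rewrite mxE.
have -> : ls_elt c = x^-1 *: ls_elt (x *: c) :> cox R F.
  rewrite /ls_elt scaler_sumr; apply: eq_bigr => j _.
  by rewrite mxE scalerA mulrA mulVf// mul1r.
by apply: Qscale; [rewrite invr_eq0|rewrite TE; apply: PQ; rewrite -P'E].
Qed.

End System.

(** * Generic smoothness on a single stratum *)

Section Strata.
Variables (K : numFieldType) (n N : nat) (mon : 'I_N -> 'X_{1..n}).
Implicit Types (s : {set 'I_n}) (a : 'I_N -> K) (p : 'I_n -> K).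

Definition avoids s (m : 'X_{1..n}) := [forall i in s, m i == 0%N].
(** For [rho] in [s], these are the exponents whose convex hull is the polytope of [rho] translated
    by e_rho. *)
Definition linear_at s rho (m : 'X_{1..n}) := (m rho == 1%N) && avoids (s :\ rho) m.
Definition off s p (m : 'X_{1..n}) : K := \prod_(i | i \notin s) p i ^+ m i.

Lemma prod_off s p (m : 'X_{1..n}) : (forall i, i \in s -> p i = 0) ->
  \prod_i p i ^+ m i = (avoids s m)%:R * off s p m.
Proof.
move=> ps; rewrite (bigID (mem s)) /=; congr (_ * _).
have [/forall_inP ms|] := boolP (avoids s m).
  by apply: big1 => i is_; rewrite (eqP (ms i is_)) expr0.
rewrite negb_forall_in => /exists_inP[i is_ mi].
by rewrite (bigD1 i)//= ps// expr0n (negbTE mi) mul0r.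
Qed.

Lemma off_neq0 s p (m : 'X_{1..n}) : (forall i, (p i == 0) = (i \in s)) -> off s p m != 0.
Proof. by move=> ps; apply/prodf_neq0 => i; rewrite -ps => pi; rewrite expf_neq0. Qed.

Lemma linear_at_val s rho (m : 'X_{1..n}) i : linear_at s rho m -> i \in s ->
  m i = (i == rho).
Proof.
move=> /andP[/eqP m1 /forall_inP m0] is_; case: eqP => [->//|/eqP ic].
by apply/eqP/m0; rewrite in_setD1 ic.
Qed.

Lemma linear_at_valP s rho (m : 'X_{1..n}) : rho \in s ->
  (forall i, i \in s -> m i = (i == rho)) -> linear_at s rho m.
Proof.
move=> rs ms; rewrite /linear_at ms// eqxx; apply/forall_inP => i.
by rewrite in_setD1 => /andP[/negbTE ir is_]; rewrite ms// ir.
Qed.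

Lemma mderiv_msum_stratum s a p rho : (forall i, i \in s -> p i = 0) -> rho \in s ->
  (msum mon a)^`M(rho).@[p] =
  \sum_j a j * (off s p (mon j) * (linear_at s rho (mon j))%:R).
Proof.
move=> ps rs; rewrite mderiv_msum; apply: eq_bigr => j _; congr (_ * _).
move: (mon j) => m; rewrite (prod_off _ ps).
have -> : off s p (m - U_(rho))%MM = off s p m.
  apply: eq_bigr => i is_; rewrite mnmBE mnm1E.
  by case: eqP is_ => [<-|_ _]; rewrite ?rs ?subn0.
rewrite mulrA -natrM mulrC; congr (_ * _%:R).
(* Truncated subtraction also lets m_rho = 0 through; the factor m_rho removes that case. *)
have -> : avoids s (m - U_(rho))%MM = (m rho <= 1)%N && avoids (s :\ rho) m.
  apply/forall_inP/andP => [ms|[m1 /forall_inP ms] i is_].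
    split; first by have := ms _ rs; rewrite mnmBE mnm1E eqxx subn_eq0.
    apply/forall_inP => i; rewrite in_setD1 => /andP[ir is_].
    by have := ms _ is_; rewrite mnmBE mnm1E [rho == i]eq_sym (negbTE ir) subn0.
  rewrite mnmBE mnm1E; case: (rho =P i) => [<-|/eqP ri]; first by rewrite subn_eq0.
  by rewrite subn0; apply: ms; rewrite in_setD1 eq_sym ri.
by rewrite /linear_at; case: (m rho) => [|[|k]]; rewrite ?mul0n ?mul1n ?muln0.
Qed.

(* [ref j] is the monomial by which [mon j] is normalized, so that the coefficients
   of an f singular at p become b_j x^(E_j) with x = 1/p, E_j = mon j - mon (ref j)
   and b in the left kernel of G. *)
Lemma stratum_generic s (ref : 'I_N -> 'I_N) l (G : 'M[K]_(N, l)) :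
  (forall j i, i \in s -> mon j i = mon (ref j) i) ->
  (\rank (kermx G) + \rank (\matrix_(j, i) ((mon j i)%:Z - (mon (ref j) i)%:Z)%:~R
     : 'M[K]_(N, n)) < N)%N ->
  exists2 P : {mpoly K[N]}, P != 0 & forall a p, P.@[a] != 0 ->
    (forall i, (p i == 0) = (i \in s)) ->
    ~ forall c, \sum_j a j * (off s p (mon j) / off s p (mon (ref j))) * G j c = 0.
Proof.
move=> refs rk; have [P PN0 P0] := monomial_image_relation (row_base (kermx G)) rk.
exists P => // a p Pa ps sum0; case/negP: Pa; apply/eqP.
pose b : 'rV[K]_N := \row_j (a j * (off s p (mon j) / off s p (mon (ref j)))).
have /submxP[t bt] : (b <= row_base (kermx G))%MS.
  rewrite eq_row_base; apply/sub_kermxP/rowP => c; rewrite !mxE -[RHS](sum0 c).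
  by apply: eq_bigr => j _; rewrite mxE.
pose x i : K := if i \in s then 1 else (p i)^-1.
have x0 i : x i != 0.
  by rewrite /x; case: ifPn => [_|is_]; rewrite ?oner_neq0// invr_eq0 ps.
rewrite -[RHS](P0 t x x0); apply: meval_eq => j; rewrite -bt mxE.
have -> : \prod_i x i ^ ((mon j i)%:Z - (mon (ref j) i)%:Z) =
    off s p (mon (ref j)) / off s p (mon j).
  rewrite (bigID (mem s)) /= big1 ?mul1r => [|i is_]; last first.
    by rewrite /x is_ exp1rz.
  rewrite /off -prodfV -big_split; apply: eq_bigr => i /= is_.
  rewrite /x (negbTE is_) expfzDr ?invr_eq0 ?ps// -exprnP -exprnN !exprVn invrK.
  by rewrite mulrC.
by rewrite -[_ / off s p (mon j)]invf_div mulfK// mulf_neq0 ?invr_eq0 ?off_neq0.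
Qed.

(** Monomials surviving on the stratum are normalized by [mon j0]; f = 0 and the Euler forms of the
    derivatives become the columns of [G]. *)
Lemma smooth_off_base_locus s j0 : avoids s (mon j0) ->
  exists2 P : {mpoly K[N]}, P != 0 & forall a p, P.@[a] != 0 ->
    (forall i, (p i == 0) = (i \in s)) ->
    ~ ((msum mon a).@[p] = 0 /\ forall i, (msum mon a)^`M(i).@[p] = 0).
Proof.
move=> j0s; pose ref j := if avoids s (mon j) then j0 else j.
set E := (\matrix_(j, i) ((mon j i)%:Z - (mon (ref j) i)%:Z)%:~R : 'M[K]_(N, n)).
pose G := row_mx E (\col_j (avoids s (mon j))%:R).
have refs j i : i \in s -> mon j i = mon (ref j) i.
  rewrite /ref; case: ifP => // /forall_inP js is_.
  by rewrite (eqP (js i is_)) (eqP (forall_inP j0s i is_)).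
have rk : (\rank (kermx G) + \rank E < N)%N.
  (* The unit vector at [j0] kills [E] but not the last column of [G], which gains one dimension
     over the rank of [E]. *)
  have ltG : (kermx G < kermx E)%MS.
    rewrite ltmxE; apply/andP; split.
      apply/sub_kermxP; have := mulmx_ker G; rewrite {2}/G mul_mx_row => /eqP.
      by rewrite row_mx_eq0 => /andP[/eqP].
    apply/negP => EG; have : (delta_mx 0 j0 : 'rV_N) *m G = 0.
      apply/sub_kermxP; apply: submx_trans EG; apply/sub_kermxP.
      by rewrite -rowE; apply/rowP => i; rewrite !mxE /ref j0s subrr.
    rewrite -rowE => /rowP/(_ (rshift n ord0)).
    by rewrite !mxE (unsplitK (inr _)) mxE j0s => /eqP; rewrite oner_eq0.
  by have := rank_ltmx ltG; rewrite (mxrank_ker E) ltn_subRL addnC.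
have [P PN0 PP] := stratum_generic refs rk.
exists P => // a p Pa ps [f0 df0]; apply: (PP a p Pa ps) => c.
have ps0 i : i \in s -> p i = 0 by rewrite -ps => /eqP.
have sum1 : \sum_j a j * ((avoids s (mon j))%:R * off s p (mon j)) = 0.
  rewrite -[RHS]f0 meval_msum; apply: eq_bigr => j _.
  by rewrite (prod_off _ ps0).
have sumi i : \sum_j a j * (mon j i)%:R * ((avoids s (mon j))%:R * off s p (mon j)) = 0.
  have := euler_msum mon a i p; rewrite df0 mulr0 => /esym; apply: etrans; apply: eq_bigr => j _.
  by rewrite (prod_off _ ps0).
rewrite -[c]splitK; case: (split c) => [i|i].
  transitivity ((\sum_j a j * (mon j i)%:R * ((avoids s (mon j))%:R * off s p (mon j))
     - (mon j0 i)%:R * \sum_j a j * ((avoids s (mon j))%:R * off s p (mon j)))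
     / off s p (mon j0)); last by rewrite sumi sum1 mulr0 subr0 mul0r.
  rewrite mulr_sumr -sumrB mulr_suml; apply: eq_bigr => j _.
  rewrite row_mxEl mxE /ref; case: (avoids s (mon j)) => /=.
    by rewrite rmorphB /=; ring.
  by rewrite subrr; ring.
transitivity ((\sum_j a j * ((avoids s (mon j))%:R * off s p (mon j)))
     / off s p (mon j0)); last by rewrite sum1 mul0r.
rewrite mulr_suml; apply: eq_bigr => j _.
by rewrite row_mxEr mxE /ref; case: (avoids s (mon j)) => /=; ring.
Qed.

(** The l equations are independent, because the [jr c] single out an identity block in [G]; the
    solutions have dimension N - l, and the exponents contribute less than l. *)
Lemma smooth_in_base_locus s l (rho : 'I_l -> 'I_n) (jr : 'I_l -> 'I_N) :
  injective rho -> (forall c, rho c \in s) ->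
  (forall c, linear_at s (rho c) (mon (jr c))) ->
  (forall ref : 'I_N -> 'I_N,
    (forall j, ref j = j \/ exists2 c, linear_at s (rho c) (mon j) & ref j = jr c) ->
    (\rank (\matrix_(j, i) ((mon j i)%:Z - (mon (ref j) i)%:Z)%:~R : 'M[K]_(N, n)) < l)%N) ->
  exists2 P : {mpoly K[N]}, P != 0 & forall a p, P.@[a] != 0 ->
    (forall i, (p i == 0) = (i \in s)) ->
    ~ forall i, (msum mon a)^`M(i).@[p] = 0.
Proof.
move=> rho_inj rs jrP rkE.
have lin_inj c c' m : linear_at s (rho c) m -> linear_at s (rho c') m -> c = c'.
  move=> mc mc'; apply/rho_inj/eqP.
  by have := linear_at_val mc' (rs c); rewrite (linear_at_val mc (rs c)) eqxx; case: eqP.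
pose ref j := if [pick c | linear_at s (rho c) (mon j)] is Some c then jr c else j.
have refP j : ref j = j \/ exists2 c, linear_at s (rho c) (mon j) & ref j = jr c.
  by rewrite /ref; case: pickP => [c jc|_]; [right; exists c|left].
have ref_lin j c : linear_at s (rho c) (mon j) -> ref j = jr c.
  rewrite /ref => jc; case: pickP => [c' jc'|/(_ c)]; last by rewrite jc.
  by rewrite (lin_inj _ _ _ jc jc').
have refs j i : i \in s -> mon j i = mon (ref j) i.
  move=> is_; case: (refP j) => [->//|[c jc ->]].
  by rewrite (linear_at_val jc is_) (linear_at_val (jrP c) is_).
pose G : 'M[K]_(N, l) := \matrix_(j, c) (linear_at s (rho c) (mon j))%:R.
have rkG : \rank G = l.
  apply/eqP; rewrite eqn_leq rank_leq_col /=.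
  have G1 : rowsub jr G = 1%:M.
    apply/matrixP => c c'; rewrite !mxE; case: (eqVneq c c') => [<-|cc'].
      by rewrite jrP.
    rewrite (negbTE (_ : ~~ linear_at _ _ _))//; apply: contra cc' => cc'.
    by rewrite (lin_inj _ _ _ (jrP c) cc').
  by rewrite -{1}(mxrank1 K l) -G1 mxrankS// rowsub_sub.
have rk : (\rank (kermx G) + \rank (\matrix_(j, i) ((mon j i)%:Z - (mon (ref j) i)%:Z)%:~R
    : 'M[K]_(N, n)) < N)%N.
  have := rank_leq_row G; rewrite mxrank_ker rkG => lN.
  by apply: (@leq_trans (N - l + l)%N); [rewrite ltn_add2l; exact: rkE|rewrite subnK].
have [P PN0 PP] := stratum_generic refs rk.
exists P => // a p Pa ps df0; apply: (PP a p Pa ps) => c.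
have ps0 i : i \in s -> p i = 0 by rewrite -ps => /eqP.
transitivity ((\sum_j a j * (off s p (mon j) * (linear_at s (rho c) (mon j))%:R))
     / off s p (mon (jr c))).
  rewrite mulr_suml; apply: eq_bigr => j _; rewrite mxE.
  have [jc|_] := boolP (linear_at s (rho c) (mon j)); last by rewrite !mulr0 mul0r.
  by rewrite (ref_lin _ _ jc) !mulr1 mulrA.
by rewrite -(mderiv_msum_stratum _ ps0 (rs c)) df0 mul0r.
Qed.
End Strata.

(** * Dimension and rank of subspaces *)

Section LinearAlgebra.

Lemma mxrank_rows_vspace (K : fieldType) (N n : nat) (M : 'M[K]_(N, n))
    (W : {vspace 'rV[K]_n}) :
  (forall j, row j M \in W) -> (\rank M <= \dim W)%N.
Proof.
move=> MW; pose B := \matrix_(i < \dim W) (vbasis W)`_i.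
apply: leq_trans (rank_leq_row B); apply: mxrankS; apply/row_subP => j.
rewrite (coord_vbasis (MW j)); apply: summx_sub => i _; apply: scalemx_sub.
have -> : (vbasis W)`_i = row i B by rewrite rowK.
exact: row_sub.
Qed.

Lemma vspace_extension (K : fieldType) (V : vectType K) (U : {vspace V}) k :
  (\dim U <= k <= \dim {:V})%N -> exists2 W : {vspace V}, (U <= W)%VS & \dim W = k.
Proof.
move=> /andP[Uk kV]; rewrite -(subnKC Uk) in kV *; elim: (k - \dim U)%N kV => [|i IH] kV.
  by exists U; rewrite ?addn0.
have [|W UW dW] := IH; first by rewrite addnS in kV; exact: ltnW.
have [v vW] : exists v, v \notin W.
  apply: contrapT => none; move: kV; rewrite addnS -dW ltnNge dimvS//.
  by apply/subvP => v _; apply: contrapT => /negP vW; apply: none; exists v.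
exists (W + <[v]>)%VS; first exact: subv_trans UW (addvSl _ _).
rewrite dimv_disjoint_sum ?dW ?addnS ?dim_vline.
  by case: eqP vW => [->|_ _]; rewrite ?mem0v// addn1.
apply/eqP; rewrite -subv0; apply/subvP => w; rewrite memv_cap => /andP[wW /vlineP[x wx]].
have [x0|x0] := eqVneq x 0; first by rewrite wx x0 scale0r mem0v.
by case/negP: vW; rewrite -[v](scalerK x0) -wx memvZ.
Qed.

Lemma hall_lines_free (K : fieldType) n k (v : 'I_k -> 'rV[K]_n) :
  hall (fun c => <[v c]>%VS) -> row_free (\matrix_c v c).
Proof.
move=> hv; have fr : free [tuple v c | c < k].
  rewrite /free eqn_leq dim_span size_tuple /=.
  have := hv [set: 'I_k]%SET; rewrite cardsT card_ord => /leq_trans; apply.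
  apply: dimvS; apply/subv_sumP => i _; rewrite -memvE; apply: memv_span.
  by apply: map_f; rewrite mem_enum.
rewrite -kermx_eq0; apply/eqP/row_matrixP => i; rewrite row0.
set u := row i _; have uV : u *m \matrix_c v c = 0 by apply/sub_kermxP/row_sub.
apply/rowP => c; rewrite [RHS]mxE; move/freeP/(_ (fun c => u 0 c)) : fr; apply.
rewrite -[RHS]uV mulmx_sum_row; apply: eq_bigr => j _.
by rewrite rowK -tnth_nth tnth_mktuple.
Qed.

End LinearAlgebra.

(** * Restriction to the locus where the variables of a cone vanish *)

Section Restrict.
Variables (R : realType) (d : nat) (F : fan d).
Local Notation C := (complex R).
Implicit Types (s : {set 'I_(nrays F)}).

Lemma mcoeff_restrict s (p : cox R F) m :
  (restrict_cone s p)@_m = if avoids s m then p@_m else 0.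
Proof.
have XE k : restrict_cone s ('X_[k] : cox R F) = if avoids s k then 'X_[k] else 0.
  rewrite /restrict_cone comp_mpolyX [in RHS]mpolyXE_id.
  have [/forall_inP ks|] := boolP (avoids s k).
    apply: eq_bigr => i _; rewrite tnth_mktuple; case: ifP => // /ks /eqP ->.
    by rewrite !expr0.
  rewrite negb_forall_in => /exists_inP[i is_ ki].
  by rewrite (bigD1 i)//= tnth_mktuple is_ expr0n (negbTE ki) mul0r.
elim/mpolyind: p => [|c k p _ _ IH].
  by rewrite /restrict_cone comp_mpoly0 mcoeff0; case: ifP.
rewrite /restrict_cone comp_mpolyD comp_mpolyZ -!/(restrict_cone s _) XE.
rewrite !mcoeffD !mcoeffZ IH; case: (eqVneq k m) => [->|km].
  by case: ifP; rewrite ?mcoeff0 ?mulr0 ?addr0.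
have -> : (if avoids s k then 'X_[k] else 0 : cox R F)@_m = 0.
  by case: ifP; rewrite ?mcoeff0// mcoeffX (negbTE km).
by rewrite mcoeffX (negbTE km) !mulr0 !add0r.
Qed.

(** Only the summand of [rho] can contain a monomial that is x_rho times variables outside [s];
    hence the restriction of f_rho does not depend on the expression chosen. *)
Lemma mcoeff_quotient s (g : 'I_(nrays F) -> cox R F) rho m : rho \in s -> avoids s m ->
  (\sum_(tau in s) 'X_tau * g tau)@_(m + U_(rho))%MM = (g rho)@_m.
Proof.
move=> rs /forall_inP ms; rewrite raddf_sum (bigD1 rho)//= big1 ?addr0.
  by rewrite mulrC addmC mcoeffMX.
move=> tau /andP[ts tr]; rewrite mulrC; apply: memN_msupp_eq0.
rewrite (perm_mem (msuppMX _ _)); apply/negP => /mapP[k _ /mnmP/(_ tau)].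
by rewrite !mnmDE !mnm1E (eqP (ms _ ts)) eqxx eq_sym (negbTE tr).
Qed.

Lemma restrict_coneZ s x (p : cox R F) : restrict_cone s (x *: p) = x *: restrict_cone s p.
Proof. exact: comp_mpolyZ. Qed.

Lemma newton_polytopeZ n x (p : {mpoly C[n]}) y : x != 0 ->
  newton_polytope p y -> newton_polytope (x *: p) y.
Proof.
move=> x0 [w [w0 w1 ->]]; exists w; split=> //.
  by rewrite (perm_big _ (msuppZ p x0)).
by rewrite [RHS](perm_big _ (msuppZ p x0)).
Qed.

End Restrict.

(** * The polytopes in terms of the monomials of the system *)

Section NewtonPolytopes.
Variables (R : realType) (d : nat) (F : fan d) (L : linear_system R F).
Local Notation C := (complex R).
Local Notation r := (nrays F).
Variables (N : nat) (mon : 'I_N -> 'X_{1..r}).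
Hypothesis mon_inj : injective mon.
Hypothesis basisP : forall f, ls_space L f <-> exists a : 'I_N -> C, f = msum mon a.
Implicit Types (s : {set 'I_r}).

Lemma hatXP (x : 'I_r -> C) : hatX (F := F) x <->
  exists2 t, t \in cones F & forall i, i \notin t -> x i != 0.
Proof.
have evalE t : (irr_monomial R t).@[x] = \prod_(i | i \notin t) x i.
  by rewrite /irr_monomial rmorph_prod; apply: eq_bigr => i _; exact: mevalXU.
split=> [hx|[t tF xt] h].
  apply: contrapT => none; apply: hx => t tF; rewrite evalE; apply: contrapT.
  by move=> /eqP/prodf_neq0 xt; apply: none; exists t.
have /eqP := h t tF; rewrite evalE; apply/negP/prodf_neq0; exact: xt.
Qed.

(** For [linear_at] monomials these points span [Delta] as a convex hull; they need not be
    extreme. *)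
Definition vertex (rho : 'I_r) (j : 'I_N) : 'rV[R]_r :=
  \row_i ((mon j - U_(rho))%MM i)%:R.

Lemma X_in_system j : ls_space L ('X_[mon j] : cox R F).
Proof.
apply/basisP; exists (fun i => (i == j)%:R); rewrite /msum (bigD1 j)//= eqxx scale1r.
by rewrite big1 ?addr0// => i /negbTE ->; rewrite scale0r.
Qed.

Lemma Dcone_sub_base_locus s : s \in cones F ->
  (Dcone (R := R) s `<=` base_locus L)%classic <-> forall j, ~~ avoids s (mon j).
Proof.
move=> sF; split=> [sub j|av x [hx xs]].
  (* A monomial avoiding [s] is nonzero at the point with coordinates 0 on [s] and 1 elsewhere. *)
  apply/negP => js; pose p i : C := (i \notin s)%:R.
  have ps i : i \in s -> p i = 0 by rewrite /p => ->.
  have [|_ /(_ _ (X_in_system j))] := sub p.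
    split=> //; apply/hatXP; exists s => // i is_; rewrite /p is_; exact: oner_neq0.
  rewrite mevalX (prod_off _ ps) js mul1r => /eqP; apply/negP/prodf_neq0 => i is_.
  by rewrite /p is_ expr1n oner_neq0.
split=> // f /basisP[a ->]; rewrite meval_msum big1// => j _.
by rewrite (prod_off _ xs) (negbTE (av j)) mul0r mulr0.
Qed.

Lemma linear_atD rho s (m k : 'X_{1..r}) : rho \in s -> avoids s m ->
  k = (m + U_(rho))%MM -> linear_at s rho k.
Proof.
move=> rs /forall_inP ms ->; apply: linear_at_valP => // i is_.
by rewrite mnmDE mnm1E (eqP (ms _ is_)) eq_sym.
Qed.

Lemma linear_atB rho s (m : 'X_{1..r}) : linear_at s rho m ->
  avoids s (m - U_(rho))%MM /\ (m - U_(rho) + U_(rho))%MM = m.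
Proof.
move=> /andP[/eqP m1 /forall_inP ms]; split; last by rewrite submK// lep1mP m1.
apply/forall_inP => i is_; rewrite mnmBE mnm1E; case: (rho =P i) => [<-|/eqP ri].
  by rewrite m1.
by rewrite subn0; apply: ms; rewrite in_setD1 eq_sym ri.
Qed.

Lemma DeltaP s rho (x : 'rV[R]_r) : Delta L s rho x <->
  exists2 P : {mpoly C[N]}, P != 0 & forall a, P.@[a] != 0 ->
    exists2 g : 'I_r -> cox R F, msum mon a = \sum_(tau in s) 'X_tau * g tau &
      newton_polytope (restrict_cone s (g rho)) x.
Proof.
apply: (generalP mon_inj basisP) => c f c0 [g -> gx].
exists (fun tau => c *: g tau).
  by rewrite scaler_sumr; apply: eq_bigr => tau _; rewrite scalerAr.
by rewrite restrict_coneZ; exact: newton_polytopeZ.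
Qed.

(** Points of [Delta] are convex combinations of the [vertex rho j]; only membership in translates
    of subspaces is kept, as degeneracy asks for no more. *)
Lemma Delta_affine s rho x : rho \in s -> Delta L s rho x ->
  (exists j, linear_at s rho (mon j)) /\
  forall (W : {vspace 'rV[R]_r}) (t : 'rV[R]_r),
    (forall j, linear_at s rho (mon j) -> t + vertex rho j \in W) -> t + x \in W.
Proof.
move=> rs /DeltaP[P PN0 PQ].
have [a /PQ [g fE [w [w0 w1 ->]]]] := mpoly_neq0_meval PN0.
have suppP m : m \in msupp (restrict_cone s (g rho)) ->
    exists2 j, linear_at s rho (mon j) & m = (mon j - U_(rho))%MM.
  rewrite mcoeff_msupp mcoeff_restrict; case: ifP => [ms|]; last by rewrite eqxx.
  rewrite -(mcoeff_quotient _ rs ms) -fE mcoeff_msum => nz.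
  have [j /eqP jm] : exists j, mon j == (m + U_(rho))%MM.
    apply: contrapT => none; move: nz; rewrite big1 ?eqxx// => j _.
    by case: eqP => [jm|_]; rewrite ?mulr0//; case: none; exists j; apply/eqP.
  by exists j; [exact: linear_atD jm|rewrite jm addmK].
split.
  case E : (msupp _) w1 suppP => [|m l] w1 suppP.
    by move: w1; rewrite big_nil => /eqP; rewrite eq_sym oner_eq0.
  by have [|j] := suppP m; [rewrite mem_head|exists j].
move=> W t tW; have -> : t = \sum_(m <- msupp (restrict_cone s (g rho))) w m *: t.
  by rewrite -scaler_suml w1 scale1r.
rewrite -big_split big_seq /=.
apply: memv_suml => m /suppP[j js ->]; rewrite -scalerDr memvZ//.
exact: tW.
Qed.

Lemma Delta_vertex s rho j : rho \in s -> (forall i, ~~ avoids s (mon i)) ->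
  linear_at s rho (mon j) -> Delta L s rho (vertex rho j).
Proof.
move=> rs av js; apply/DeltaP.
exists 'X_j; first by rewrite -msupp_eq0 msuppX.
move=> a; rewrite mevalXU => aj.
(* To split f, each monomial is assigned to one variable of [s] dividing it. *)
have /choice[tau tauP] i : exists t, (t \in s) && (mon i t != 0%N).
  by have := av i; rewrite negb_forall_in => /exists_inP[t ts ti]; exists t; rewrite ts.
pose g t : cox R F := \sum_(i | tau i == t) a i *: 'X_[mon i - U_(t)].
have fE : msum mon a = \sum_(t in s) 'X_t * g t.
  rewrite /msum (partition_big tau (mem s)) => [|i _]; last by case/andP: (tauP i).
  apply: eq_bigr => t ts; rewrite mulr_sumr; apply: eq_bigr => i /eqP it.
  rewrite -scalerAr mulrC -mpolyXD submK// lep1mP -it.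
  by case/andP: (tauP i).
exists g => //; set h := restrict_cone _ _.
have [avj jE] := linear_atB js.
have hj : (mon j - U_(rho))%MM \in msupp h.
  rewrite mcoeff_msupp mcoeff_restrict avj -(mcoeff_quotient _ rs avj) -fE jE.
  by rewrite mcoeff_msum_mon.
exists (fun m => (m == (mon j - U_(rho))%MM)%:R); split.
- by move=> m; exact: ler0n.
- rewrite (bigD1_seq _ hj) ?msupp_uniq//= eqxx big1 ?addr0// => m /negbTE ->.
  by [].
rewrite (bigD1_seq _ hj) ?msupp_uniq//= eqxx scale1r big1 ?addr0// => m /negbTE ->.
by rewrite scale0r.
Qed.

End NewtonPolytopes.

(** * Both directions of the criterion *)

Section Quasismoothness.
Variables (R : realType) (d : nat) (F : fan d) (L : linear_system R F).
Local Notation C := (complex R).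
Local Notation r := (nrays F).
Variables (N : nat) (mon : 'I_N -> 'X_{1..r}).
Hypothesis mon_inj : injective mon.
Hypothesis basisP : forall f, ls_space L f <-> exists a : 'I_N -> C, f = msum mon a.
Implicit Types (s : {set 'I_r}).

Lemma quasismoothP : general L (@quasismooth R d F) <->
  exists2 P : {mpoly C[N]}, P != 0 &
    forall a, P.@[a] != 0 -> quasismooth (msum mon a : cox R F).
Proof.
apply: (generalP mon_inj basisP) => c f c0 fq [x [hx fx dfx]]; apply: fq; exists x.
split=> // [|i]; apply: (mulfI c0); rewrite mulr0.
  by rewrite -mevalZ fx.
by rewrite -mevalZ -mderivZ dfx.
Qed.

Lemma monomials_same_class i j : exists m : 'rV[int]_d,
  forall l, (mon i l)%:Z - (mon j l)%:Z = pairing m (ray l).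
Proof.
have [D hom] := ls_homog L.
have cls k : same_class (fun l => (mon k l)%:Z) D.
  have [c cE] := X_in_system basisP k.
  have : mon k \in msupp ('X_[mon k] : cox R F) by rewrite msuppX inE.
  rewrite cE mcoeff_msupp /ls_elt raddf_sum /= => nz.
  have [l lk] : exists l : 'I_(ls_dim L).+1, mon k \in msupp (ls_basis l).
    apply: contrapT => none; move: nz; rewrite big1 ?eqxx// => l _.
    rewrite mcoeffZ memN_msupp_eq0 ?mulr0//; apply/negP => lk; apply: none.
    by exists l.
  exact: hom lk.
have [mi miE] := cls i; have [mj mjE] := cls j; exists (mi - mj) => l.
transitivity ((mon i l)%:Z - D l - ((mon j l)%:Z - D l)).
  by rewrite opprB addrA subrK.
rewrite miE mjE /pairing -sumrB.
by apply: eq_bigr => k _; rewrite !mxE mulrBl.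
Qed.

Definition dependent_at s :=
  dependent (fun rho => rho \in s /\ (Delta L s rho !=set0)%classic) (Delta L s).

(** Inside the base locus, the dependence hypothesis is applied to a minimal cone [t] containing
    [s], and homogeneity carries it from [t] back to [s]. *)
Lemma stratum_quasismooth s t0 :
  (forall t : {set 'I_r}, t \in cones F ->
     (Dcone (R := R) t `<=` base_locus L)%classic -> dependent_at t) ->
  t0 \in cones F -> s \subset t0 ->
  exists2 P : {mpoly C[N]}, P != 0 & forall a p, P.@[a] != 0 ->
    (forall i, (p i == 0) = (i \in s)) ->
    ~ ((msum mon a).@[p] = 0 /\ forall i, (msum mon a)^`M(i).@[p] = 0).
Proof.
move=> dep t0F st0.
have [[j0 j0s]|base] := pselect (exists j, avoids s (mon j)).
  exact: (smooth_off_base_locus C j0s).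
have {}base j : ~~ avoids s (mon j) by apply/negP => js; apply: base; exists j.
have [t [tF st tmin]] := minimal_cone t0F st0.
have tbase j : ~~ avoids t (mon j).
  apply: contra (base j) => /forall_inP jt; apply/forall_inP => i is_.
  exact/jt/(fintype.subsetP st).
have [T [TJ [T0 [W [dW TW]]]]] := dep t tF (proj2 (Dcone_sub_base_locus basisP tF) tbase).
have /choice[jr jrP] (c : 'I_#|T|) : exists j, linear_at t (enum_val c) (mon j).
  have [rt [x xD]] := TJ _ (enum_valP c).
  by have [[j jt] _] := Delta_affine mon_inj basisP rt xD; exists j.
have rt (c : 'I_#|T|) : enum_val c \in t by have [] := TJ _ (enum_valP c).
(* Some variable of [s] divides [mon (jr c)], and among those of [t] only the one of [enum_val c]
   does. *)
have rs (c : 'I_#|T|) : enum_val c \in s.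
  have := base (jr c); rewrite negb_forall_in => /exists_inP[i is_].
  rewrite (linear_at_val (jrP c)) ?(fintype.subsetP st)//.
  by case: (i =P enum_val c) => [<-|].
have jrs (c : 'I_#|T|) : linear_at s (enum_val c) (mon (jr c)).
  apply: linear_at_valP => // i is_; apply: linear_at_val (jrP c) _.
  exact: (fintype.subsetP st).
(* The difference of the two exponents comes from a character that is nonnegative on the rays of [t]
   and zero on those of [s]; minimality makes it zero on [t]. *)
have s_to_t (c : 'I_#|T|) j : linear_at s (enum_val c) (mon j) -> linear_at t (enum_val c) (mon j).
  move=> js; have [m mE] := monomials_same_class j (jr c).
  apply: linear_at_valP => // i it; rewrite -(linear_at_val (jrP c) it).
  apply/eqP; rewrite -eqz_nat -subr_eq0 mE; apply/eqP; apply: (tmin) => // k.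
    move=> kt; rewrite -mE (linear_at_val (jrP c) kt).
    case: (k =P enum_val c) => [->|_]; last by rewrite subr0.
    by rewrite (linear_at_val js (rs c)) eqxx subrr.
  move=> ks; rewrite -mE (linear_at_val js ks) (linear_at_val (jrs c) ks).
  by rewrite subrr.
suff /(smooth_in_base_locus enum_val_inj rs jrs) [P PN0 PP] :
    forall ref : 'I_N -> 'I_N,
    (forall j, ref j = j \/
      exists2 c : 'I_#|T|, linear_at s (enum_val c) (mon j) & ref j = jr c) ->
    (\rank (\matrix_(j, i) ((mon j i)%:Z - (mon (ref j) i)%:Z)%:~R : 'M[C]_(N, r))
      < #|T|)%N.
  by exists P => // a p Pa ps [_]; exact: PP Pa ps.
move=> ref refP.
(* The polytopes are real, so the rank is computed over [R], which does not change it. *)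
pose M : 'M[R]_(N, r) := \matrix_(j, i) ((mon j i)%:Z - (mon (ref j) i)%:Z)%:~R.
have -> : (\matrix_(j, i) ((mon j i)%:Z - (mon (ref j) i)%:Z)%:~R : 'M[C]_(N, r)) =
    map_mx (real_complex R) M.
  by apply/matrixP => j i; rewrite !mxE rmorph_int.
rewrite mxrank_map -(prednK T0) ltnS -dW; apply: mxrank_rows_vspace => j.
have rowE : row j M = \row_i ((mon j i)%:R - (mon (ref j) i)%:R).
  by apply/rowP => i; rewrite !mxE rmorphB.
have [e|[c jc e]] := refP j.
  rewrite rowE e (_ : \row_i _ = 0) ?mem0v//; apply/rowP => i.
  by rewrite !mxE subrr.
have [v vW] := TW _ (enum_valP c).
have mem_vertex k : linear_at t (enum_val c) (mon k) -> v + vertex R mon (enum_val c) k \in W.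
  by move=> kt; apply: vW; exact: Delta_vertex.
(* A nontrivial row is a difference of two points of one polytope, whose translate lies in [W]. *)
have -> : row j M = (v + vertex R mon (enum_val c) j) - (v + vertex R mon (enum_val c) (jr c)).
  rewrite rowE e opprD addrACA subrr add0r; apply/rowP => i; rewrite !mxE !mnmBE mnm1E.
  case: (enum_val c =P i) => [<-|_]; last by rewrite !subn0.
  by rewrite (linear_at_val (s_to_t _ _ jc) (rt c)) (linear_at_val (jrP c) (rt c)) !subrr.
by rewrite memvB ?mem_vertex// s_to_t.
Qed.

Lemma quasismooth_of_dependent :
  (forall t : {set 'I_r}, t \in cones F ->
     (Dcone (R := R) t `<=` base_locus L)%classic -> dependent_at t) ->
  general L (@quasismooth R d F).
Proof.
move=> dep; apply/quasismoothP.
have /choice[P PP] s : exists P : {mpoly C[N]}, P != 0 /\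
    forall t0, t0 \in cones F -> s \subset t0 -> forall a p, P.@[a] != 0 ->
    (forall i, (p i == 0) = (i \in s)) ->
    ~ ((msum mon a).@[p] = 0 /\ forall i, (msum mon a)^`M(i).@[p] = 0).
  have [[t0 t0F st0]|none] := pselect (exists2 t0, t0 \in cones F & s \subset t0).
    by have [P PN0 PP] := stratum_quasismooth dep t0F st0; exists P.
  (* A set contained in no cone gives a stratum outside [hatX], hence no condition. *)
  exists 1; split; first exact: oner_neq0.
  by move=> t0 t0F st0; case: none; exists t0.
exists (\prod_s P s); first by apply/prodf_neq0 => s _; have [] := PP s.
move=> a; rewrite rmorph_prod => /prodf_neq0 Pa [x [/hatXP[t0 t0F xt] fx dfx]].
pose s := [set i | x i == 0]; have [_ Ps] := PP s.
have st0 : s \subset t0.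
  apply/fintype.subsetP => i; rewrite inE; apply: contraLR; exact: xt.
by apply: (Ps _ t0F st0 a x) => // [|i]; [exact: Pa|rewrite inE].
Qed.

Lemma singular_stratum_point s (b : 'I_N -> C) (x : 'I_r -> C) :
  s \in cones F -> (forall j, ~~ avoids s (mon j)) -> (forall i, x i != 0) ->
  (forall rho, rho \in s -> \sum_(j | linear_at s rho (mon j)) b j = 0) ->
  ~ quasismooth (msum mon (torus_scale mon b x) : cox R F).
Proof.
(* Inverting [x] off [s] cancels the rescaling there; each derivative along [s] is then x_rho times
   a balanced sum. *)
move=> sF base x0 bal; apply; pose p i := if i \in s then 0 else (x i)^-1.
have ps i : i \in s -> p i = 0 by rewrite /p => ->.
exists p; split=> [||rho].
- by apply/hatXP; exists s => // i /negbTE is_; rewrite /p is_ invr_eq0.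
- by rewrite meval_msum big1// => j _; rewrite (prod_off _ ps) (negbTE (base j)) mul0r mulr0.
have [rs|rs] := boolP (rho \in s); last first.
  rewrite mderiv_msum big1// => j _.
  have := base j; rewrite negb_forall_in => /exists_inP[i is_ ji].
  rewrite (bigD1 i)//= mnmBE mnm1E ps//; case: (rho =P i) => [e|_].
    by rewrite e is_ in rs.
  by rewrite subn0 expr0n (negbTE ji) mul0r !mulr0.
rewrite (mderiv_msum_stratum _ _ ps rs).
transitivity (x rho * \sum_(j | linear_at s rho (mon j)) b j); last by rewrite bal// mulr0.
rewrite mulr_sumr [RHS]big_mkcond; apply: eq_bigr => j _.
have [js|_] := boolP (linear_at s rho (mon j)); last by rewrite !mulr0.
rewrite mulr1 /torus_scale (bigID (mem s)) /= /off -mulrA -mulrA -big_split /=.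
rewrite [X in _ * (_ * X)]big1 => [|i is_]; last first.
  by rewrite /p (negbTE is_) exprVn mulfV// expf_neq0.
rewrite mulr1 (bigD1 rho)//= (linear_at_val js rs) eqxx expr1 big1.
  by rewrite mulr1 mulrC.
by move=> i /andP[is_ /negbTE ir]; rewrite (linear_at_val js is_) ir.
Qed.

Lemma dependent_of_quasismooth s : general L (@quasismooth R d F) ->
  s \in cones F -> (Dcone (R := R) s `<=` base_locus L)%classic -> dependent_at s.
Proof.
move=> /quasismoothP[P PN0 Pq] sF /(Dcone_sub_base_locus basisP sF) base.
apply: contrapT => indep.
(* Indices of the nonempty polytopes. *)
pose J := [set rho in s | [exists j, linear_at s rho (mon j)]].
pose rho (c : 'I_#|J|) : 'I_r := enum_val c.
have rs c : rho c \in s by have := enum_valP c; rewrite inE => /andP[].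
have /choice[jr jrP] c : exists j, linear_at s (rho c) (mon j).
  by have := enum_valP c; rewrite inE => /andP[_ /existsP].
have lin_inj c c' j : linear_at s (rho c) (mon j) -> linear_at s (rho c') (mon j) -> c = c'.
  move=> jc jc'; apply/enum_val_inj/eqP; have := linear_at_val jc' (rs c).
  by rewrite (linear_at_val jc (rs c)) eqxx; case: eqP.
pose dv c j : 'rV[R]_r := \row_i ((mon j i)%:R - (mon (jr c) i)%:R).
pose U c := (\sum_(j | linear_at s (rho c) (mon j)) <[dv c j]>)%VS.
(* [U c] is the space of directions of a polytope, so a violation of Hall's condition, its span
   enlarged to dimension #T - 1, is a degenerate subcollection. *)
have hallU : hall U.
  move=> T; rewrite leqNgt; apply/negP => dT; apply: indep.
  have T0 : (0 < #|T|)%N by exact: leq_ltn_trans dT.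
  have card_rhoT : #|rho @: T| = #|T| by rewrite card_imset//; exact: enum_val_inj.
  exists (rho @: T)%SET; split.
    move=> _ /imsetP[c cT ->]; split=> //; exists (vertex R mon (rho c) (jr c)).
    exact: Delta_vertex.
  rewrite /degenerate card_rhoT; split=> //.
  have [|W UW dW] := @vspace_extension _ _ (\sum_(i in T) U i)%VS #|T|.-1.
    rewrite -ltnS (prednK T0) dT dimvf /dim /= mul1n.
    apply: leq_trans (leq_pred _) _; rewrite -card_rhoT -[X in (_ <= X)%N]card_ord.
    exact: max_card.
  exists W; split=> // _ /imsetP[c cT ->]; exists (- vertex R mon (rho c) (jr c)) => x.
  move=> /(Delta_affine mon_inj basisP (rs c))[_]; apply=> j jc.
  have -> : - vertex R mon (rho c) (jr c) + vertex R mon (rho c) j = dv c j.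
    apply/rowP => i; rewrite !mxE !mnmBE mnm1E addrC; case: (rho c =P i) => [<-|_].
      by rewrite (linear_at_val jc (rs c)) (linear_at_val (jrP c) (rs c)) !subrr.
    by rewrite !subn0.
  apply: (subvP UW); apply: (subvP (sumv_sup c cT (subvv _))).
  by rewrite memvE /U; apply: (sumv_sup j).
have [v vU hv] := rado_subspaces hallU.
have /choice[y yP] c : exists y : 'I_N -> R,
    v c = \sum_(j | linear_at s (rho c) (mon j)) y j *: dv c j.
  have [u uU ->] := memv_sumP (vU c).
  have /choice[y yP] j : exists y, linear_at s (rho c) (mon j) -> u j = y *: dv c j.
    have [jc|] := boolP (linear_at s (rho c) (mon j)); last by exists 0.
    by have /vlineP[y ->] := uU j jc; exists y.
  by exists y; apply: eq_bigr => j jc; exact: yP.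
pose gr j := [pick c | linear_at s (rho c) (mon j)].
have grE j c : (gr j == Some c) = linear_at s (rho c) (mon j).
  rewrite /gr; case: pickP => [c' jc'|/(_ c) -> //].
  by apply/eqP/idP => [[<-]//|jc]; congr Some; exact: lin_inj jc' jc.
(* The correction at [jr c] balances the group and turns the combination of differences [v c] into
   the sum of b_j m over the group. *)
pose b j : R := if gr j is Some c then
  y c j - (j == jr c)%:R * \sum_(i | linear_at s (rho c) (mon i)) y c i else 0.
have bE c j : linear_at s (rho c) (mon j) ->
    b j = y c j - (j == jr c)%:R * \sum_(i | linear_at s (rho c) (mon i)) y c i.
  by rewrite -grE /b => /eqP ->.
have sum_b c (f : 'I_N -> R) : \sum_(j | linear_at s (rho c) (mon j)) b j * f j =
    \sum_(j | linear_at s (rho c) (mon j)) y c j * (f j - f (jr c)).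
  under eq_bigr => j jc do rewrite (bE _ _ jc) mulrBl.
  rewrite sumrB (bigD1 (jr c)) ?jrP//= [X in _ - X](bigD1 (jr c)) ?jrP//= eqxx mul1r.
  rewrite [X in _ - (_ + X)]big1 ?addr0 => [|j /andP[_ /negbTE ->]]; last by rewrite !mul0r.
  rewrite -[X in X - _](bigD1 (jr c) (F := fun j => y c j * f j)) ?jrP//.
  rewrite mulr_suml -sumrB; apply: eq_bigr => j _; ring.
have bal c : \sum_(j | linear_at s (rho c) (mon j)) b j = 0.
  have := sum_b c (fun=> 1); under eq_bigr => j _ do rewrite mulr1.
  by move=> ->; apply: big1 => j _; rewrite subrr mulr0.
have /row_freeP[W VW] := hall_lines_free hv.
pose bC j : C := (b j)%:C%C.
have lg : log_gradient mon gr bC = map_mx (real_complex R) (\matrix_c v c).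
  apply/matrixP => c i; rewrite !mxE yP summxE -[RHS]/(real_complex R _).
  under eq_bigl => j do rewrite grE.
  have := sum_b c (fun j => (mon j i)%:R) => e.
  transitivity (real_complex R (\sum_(j | linear_at s (rho c) (mon j)) b j * (mon j i)%:R)).
    by rewrite rmorph_sum; apply: eq_bigr => j _; rewrite rmorphM rmorph_nat.
  by rewrite e; apply: congr1; apply: eq_bigr => j _; rewrite !mxE.
have bal_of (b' : 'I_N -> C) : balanced gr b' <->
    forall c, \sum_(j | linear_at s (rho c) (mon j)) b' j = 0.
  have E c : \sum_(j | gr j == Some c) b' j = \sum_(j | linear_at s (rho c) (mon j)) b' j.
    by apply: eq_bigl => j; exact: grE.
  by split=> h c; [rewrite -E|rewrite E]; exact: h.
(* Every rescaled balanced vector yields a singular f, so [P] vanishes on the dense image. *)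
case/negP: PN0; apply/eqP; apply: (@torus_scale_dense C N r _ mon gr bC (map_mx (real_complex R) W)).
- by apply/bal_of => c; rewrite -rmorph_sum bal.
- by rewrite lg -map_mxM VW map_mx1.
move=> b' x /bal_of bal' x0; apply: contrapT => /eqP /Pq; apply: (singular_stratum_point sF base x0).
(* Outside [J] the sum to be balanced is empty. *)
move=> rho0 rs0; have [J0|J0] := boolP (rho0 \in J).
  have <- : rho (enum_rank_in J0 rho0) = rho0 by rewrite /rho enum_rankK_in.
  exact: bal'.
rewrite big_pred0// => j; apply/negP => js; case/negP: J0; rewrite inE rs0.
by apply/existsP; exists j.
Qed.

End Quasismoothness.

Theorem theorem3p6 (R : realType) (d : nat) (F : fan d)
    (L : linear_system R F) :
  no_torus_factors F ->
  monomial_system L ->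
  (general L (@quasismooth R d F) <->
   forall s : {set 'I_(nrays F)}, s \in cones F ->
     (Dcone s `<=` base_locus L)%classic ->
     dependent (fun rho => rho \in s /\ (Delta L s rho !=set0)%classic)
               (Delta L s)).
Proof.
move=> _ /monomial_system_basis[N [mon [mon_inj basisP]]]; split.
  move=> qs s sF base; exact: (dependent_of_quasismooth mon_inj basisP qs sF base).
exact: (quasismooth_of_dependent mon_inj basisP).
Qed.
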